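(* The total search problem Ward-Szabó belongs to the complexity class $\mathsf{PPP}$.
   Context: The problem Ward-Szabó: the input is a Boolean circuit $C:\{0,1\}^{2n}\times\{0,1\}^{2n}\to\{0,1\}^n$ (viewed as assigning a colour to each edge of the complete graph on vertex set $\{0,1\}^{2n}$) together with three distinct nodes $a,b,c\in\{0,1\}^{2n}$ with $C(a,b)\neq C(a,c)$. A solution is either (1) three distinct nodes $x,y,z\in\{0,1\}^{2n}$ with $C(x,y)=C(x,z)\neq C(y,z)$, or (2) two distinct nodes $x,y$ with $C(x,y)\neq C(y,x)$. A polynomial-time reduction from a search problem $R$ to a search problem $S$ consists of polynomial-time computable functions $f,g$ such that whenever $y$ is a solution of $S$ on input $f(x)$, $g(x,y)$ is a solution of $R$ on input $x$. The problem Pigeon: given a Boolean circuit $f:\{0,1\}^n\to\{0,1\}^n$ and $v^*\in\{0,1\}^n$, find either $x$ with $f(x)=v^*$ or two distinct $x,y$ with $f(x)=f(y)$. $\mathsf{PPP}$ is the class of all search problems polynomial-time reducible to Pigeon. *)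

(* Defs.v *)
From mathcomp Require Import all_boot all_algebra.

Set Implicit Arguments.
Unset Strict Implicit.
Unset Printing Implicit Defensive.

Notation bits := (seq bool).

Inductive move := MoveLeft | Stay | MoveRight.

(* The tape alphabet contains the blank [None], the two bits [Some (inl b)] and
   an arbitrary finite set [A] of auxiliary symbols [Some (inr a)]. *)
Definition symbol (A : finType) : finType := option (bool + A).

(* [transition q r] is [None] when the machine halts in state [q] while its
   heads read [r]; otherwise it gives the next state and, for each tape, the
   symbol to write and the subsequent head move. *)
Record TM (k : nat) := MkTM {
  state : finType;
  aux : finType;
  start : state;
  transition : state -> {ffun 'I_k -> symbol aux} ->
               option (state * {ffun 'I_k -> symbol aux * move})
}.

(* A two-way infinite tape: [left_part] lists the cells to the left of the head,
   nearest first; [right_part] lists the scanned cell and then the cells to its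
   right.  All the cells beyond the two lists are blank. *)
Record tape (A : finType) := MkTape {
  left_part : seq (symbol A);
  right_part : seq (symbol A)
}.

Definition read A (t : tape A) : symbol A := head None (right_part t).

Definition write A (s : symbol A) (t : tape A) : tape A :=
  MkTape (left_part t) (s :: behead (right_part t)).

Definition shift A (m : move) (t : tape A) : tape A :=
  match m with
  | MoveLeft => MkTape (behead (left_part t))
                       (head None (left_part t) :: right_part t)
  | Stay => t
  | MoveRight => MkTape (read t :: left_part t) (behead (right_part t))
  end.

Record config k (M : TM k) := MkConfig {
  cfg_state : state M;
  cfg_tapes : {ffun 'I_k -> tape (aux M)}
}.

Definition step k (M : TM k) (c : config M) : option (config M) :=
  if transition (cfg_state c) [ffun i => read (cfg_tapes c i)] is Some (q, act)
  then Some (MkConfig q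
         [ffun i => shift (act i).2 (write (act i).1 (cfg_tapes c i))])
  else None.

(* The halting configuration reached from [c], if any, in at most [t] steps. *)
Fixpoint run k (M : TM k) (t : nat) (c : config M) : option (config M) :=
  match step c, t with
  | None, _ => Some c
  | Some c', t'.+1 => run t' c'
  | Some _, 0 => None
  end.

(* The i-th input is on the i-th tape, with the head on its first symbol; the
   remaining tapes are blank. *)
Definition init_config k (M : TM k) (xs : seq bits) : config M :=
  MkConfig (start M)
    [ffun i : 'I_k => MkTape [::] [seq Some (inl b) | b <- nth [::] xs i]].

Fixpoint bit_prefix (A : finType) (s : seq (symbol A)) : bits :=
  if s is Some (inl b) :: s' then b :: bit_prefix s' else [::].

(* The output is the maximal block of bits that starts at the head position. *)
Definition tape_output A (t : tape A) : bits := bit_prefix (right_part t).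

(* The machines have m input tapes, k work tapes and one output tape; the time
   bound is a polynomial in the total length of the inputs. *)
Definition polytime (m : nat) (F : m.-tuple bits -> bits) : Prop :=
  exists (k : nat) (M : TM (m + k).+1) (p : {poly nat}),
  forall xs : m.-tuple bits,
  exists2 c : config M,
    run p.[sumn [seq size x | x <- xs]]%R (init_config M xs) = Some c
    & tape_output (cfg_tapes c ord_max) = F xs.

Record search_problem := MkSearchProblem {
  instance : bits -> Prop;
  solution : bits -> bits -> Prop
}.

Definition total_problem (R : search_problem) : Prop :=
  forall x, instance R x -> exists y, solution R x y.

Definition reducible (R S : search_problem) : Prop :=
  exists (f : 1.-tuple bits -> bits) (g : 2.-tuple bits -> bits),
    [/\ polytime f, polytime g
      & forall x, instance R x ->
          instance S (f [tuple x]) /\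
          forall y, solution S (f [tuple x]) y -> solution R x (g [tuple x; y])].

Inductive gate :=
  | Const of bool
  | Not of nat
  | And of nat & nat
  | Or of nat & nat.

Definition gate_wf (w : nat) (g : gate) : bool :=
  match g with
  | Const _ => true
  | Not i => i < w
  | And i j | Or i j => (i < w) && (j < w)
  end.

Fixpoint gates_wf (w : nat) (gs : seq gate) : bool :=
  if gs is g :: gs' then gate_wf w g && gates_wf w.+1 gs' else true.

(* The wires are numbered from 0: first the p inputs, then the gates in order.
   A gate may only refer to earlier wires, so that the circuit is acyclic. *)
Record circuit (p q : nat) := MkCircuit {
  gates : seq gate;
  outputs : q.-tuple nat;
  circuit_wf :
    gates_wf p gates && all (fun i => i < p + size gates) outputs
}.

Definition gate_value (w : bits) (g : gate) : bool :=
  match g with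
  | Const b => b
  | Not i => ~~ nth false w i
  | And i j => nth false w i && nth false w j
  | Or i j => nth false w i || nth false w j
  end.

Definition wire_values (gs : seq gate) (x : bits) : bits :=
  foldl (fun w g => rcons w (gate_value w g)) x gs.

Definition ceval p q (C : circuit p q) (x : p.-tuple bool) : q.-tuple bool :=
  map_tuple (nth false (wire_values (gates C) x)) (outputs C).

(* Each encoding is self-delimiting, so that concatenations can be parsed.  Wire
   numbers are written in unary, which keeps the length of the encoding of a
   circuit polynomial in its numbers of inputs, gates and outputs. *)
Definition enc_nat (n : nat) : bits := rcons (nseq n true) false.

Fixpoint enc_seq (T : Type) (enc : T -> bits) (s : seq T) : bits :=
  if s is x :: s' then true :: enc x ++ enc_seq enc s' else [:: false].

Definition enc_bits (s : bits) : bits := enc_seq (fun b => [:: b]) s.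

Definition enc_gate (g : gate) : bits :=
  match g with
  | Const b => [:: false; false; b]
  | Not i => [:: false; true] ++ enc_nat i
  | And i j => [:: true; false] ++ enc_nat i ++ enc_nat j
  | Or i j => [:: true; true] ++ enc_nat i ++ enc_nat j
  end.

Definition enc_circuit p q (C : circuit p q) : bits :=
  enc_nat p ++ enc_seq enc_gate (gates C) ++ enc_seq enc_nat (outputs C).

Record pigeon_input := MkPigeon {
  pg_n : nat;
  pg_f : circuit pg_n pg_n;
  pg_v : pg_n.-tuple bool
}.

Definition enc_pigeon (I : pigeon_input) : bits :=
  enc_circuit (pg_f I) ++ enc_bits (pg_v I).

Definition pigeon_solution (I : pigeon_input) (s : bits) : Prop :=
  (exists x : (pg_n I).-tuple bool,
     s = enc_seq enc_bits [:: val x] /\ ceval (pg_f I) x = pg_v I)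
  \/
  (exists x y : (pg_n I).-tuple bool,
     [/\ s = enc_seq enc_bits [:: val x; val y], x <> y
       & ceval (pg_f I) x = ceval (pg_f I) y]).

Definition Pigeon : search_problem := {|
  instance w := exists I, w = enc_pigeon I;
  solution w s := exists2 I, w = enc_pigeon I & pigeon_solution I s
|}.

Definition PPP (R : search_problem) : Prop := reducible R Pigeon.

Notation node n := ((2 * n).-tuple bool).

Record ws_input := MkWS {
  ws_n : nat;
  ws_C : circuit (2 * ws_n + 2 * ws_n) ws_n;
  ws_a : node ws_n;
  ws_b : node ws_n;
  ws_c : node ws_n
}.

Definition colour n (C : circuit (2 * n + 2 * n) n) (x y : node n) :
  n.-tuple bool := ceval C (cat_tuple x y).

Definition distinct3 (T : Type) (x y z : T) : Prop :=
  [/\ x <> y, x <> z & y <> z].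

Definition ws_valid (I : ws_input) : Prop :=
  distinct3 (ws_a I) (ws_b I) (ws_c I) /\
  colour (ws_C I) (ws_a I) (ws_b I) <> colour (ws_C I) (ws_a I) (ws_c I).

Definition enc_ws (I : ws_input) : bits :=
  enc_circuit (ws_C I) ++
  enc_bits (ws_a I) ++ enc_bits (ws_b I) ++ enc_bits (ws_c I).

Definition ws_solution (I : ws_input) (s : bits) : Prop :=
  (exists x y z : node (ws_n I),
     [/\ s = enc_seq enc_bits [:: val x; val y; val z], distinct3 x y z,
         colour (ws_C I) x y = colour (ws_C I) x z
       & colour (ws_C I) x z <> colour (ws_C I) y z])
  \/
  (exists x y : node (ws_n I),
     [/\ s = enc_seq enc_bits [:: val x; val y], x <> y
       & colour (ws_C I) x y <> colour (ws_C I) y x]).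

Definition WardSzabo : search_problem := {|
  instance w := exists2 I, ws_valid I & w = enc_ws I;
  solution w s := exists I, [/\ ws_valid I, w = enc_ws I & ws_solution I s]
|}.

Definition prefix_free (T : Type) (enc : T -> bits) : Prop :=
  forall x y u v, enc x ++ u = enc y ++ v -> x = y /\ u = v.

Lemma enc_nat_pf : prefix_free enc_nat.
Proof.
rewrite /enc_nat; elim=> [|x IH] [|y] u v //=; first by case.
by case=> /IH[-> ->].
Qed.

Lemma enc_seq_pf (T : Type) (enc : T -> bits) :
  prefix_free enc -> prefix_free (enc_seq enc).
Proof.
move=> pf; elim=> [|x s IH] [|y t] u v //=; first by case.
by case; rewrite -!catA => /pf[-> /IH[-> ->]].
Qed.

Lemma enc_bits_pf : prefix_free enc_bits.
Proof. by apply: enc_seq_pf => x y u v /= [-> ->]. Qed.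

Lemma enc_gate_pf : prefix_free enc_gate.
Proof.
case=> [b|i|i j|i j] [b'|i'|i' j'|i' j'] u v //=; rewrite -?catA; case.
- by move=> -> ->.
- by move=> /enc_nat_pf[-> ->].
- by move=> /enc_nat_pf[-> /enc_nat_pf[-> ->]].
- by move=> /enc_nat_pf[-> /enc_nat_pf[-> ->]].
Qed.

Lemma enc_circuit_pf p q p' q' (C : circuit p q) (C' : circuit p' q') u v :
  enc_circuit C ++ u = enc_circuit C' ++ v ->
  [/\ p = p', gates C = gates C', val (outputs C) = val (outputs C') & u = v].
Proof.
rewrite /enc_circuit -!catA => /enc_nat_pf[ep /(enc_seq_pf enc_gate_pf)[eg]].
by case/(enc_seq_pf enc_nat_pf).
Qed.

Lemma circuit_inj p q (C C' : circuit p q) :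
  gates C = gates C' -> val (outputs C) = val (outputs C') -> C = C'.
Proof.
case: C C' => [gs os wf] [gs' os' wf'] /= eg /val_inj eo.
by case: gs' / eg wf'; case: os' / eo => wf'; rewrite (bool_irrelevance wf wf').
Qed.

Lemma enc_pigeon_inj : injective enc_pigeon.
Proof.
case=> [n f v] [n' f' v']; rewrite /enc_pigeon /=.
rewrite -(cats0 (enc_bits v)) -(cats0 (enc_bits v')) => /enc_circuit_pf[en].
case: n' / en f' v' => f' v' eg eo /enc_bits_pf[/val_inj-> _].
by rewrite (circuit_inj eg eo).
Qed.

Lemma enc_ws_inj : injective enc_ws.
Proof.
case=> [n C a b c] [n' C' a' b' c']; rewrite /enc_ws /=.
rewrite -(cats0 (enc_bits c)) -(cats0 (enc_bits c')) => /enc_circuit_pf[_].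
move=> eg eo; have en : n = n' by have := congr1 size eo; rewrite !size_tuple.
case: n' / en C' a' b' c' eg eo => C' a' b' c' eg eo.
case/enc_bits_pf=> /val_inj-> /enc_bits_pf[/val_inj->].
by case/enc_bits_pf=> /val_inj-> _; rewrite (circuit_inj eg eo).
Qed.

(* Main.v *)
(* Let [j] be a bit on which [C(a,b)] and [C(a,c)] differ, and for a node [x] let
   [w(x)] be [c] if [C(x,a)] and [C(a,b)] agree on bit [j], and [b] otherwise;
   thus [w(x)] depends only on [C(x,a)], and [C(a,w(x)) <> C(x,a)].  In a symmetric
   colouring without two-coloured triangles [F(x) = (C(x,a), C(x,w(x)))] is
   injective and avoids the value 0: if [F(x) = F(y)] and [x <> y], then the triangles
   [a x y] and [w x y] are monochromatic, of the common colour [C(x,y)], so that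
   [a x w] has exactly two colours; and a value [(k,k)] of [F] at [x] makes
   [x a w] two-coloured.  Hence a solution of Pigeon for [F] and 0 exhibits a
   violation among the nodes [a], [b], [c] and those of the solution, which is
   found by trying all triples.

   Polynomial-time computability is established by programs on stacks, a tape
   being used as the stack that starts at its head.  The functions that such
   programs compute from the contents of some stacks are closed under
   composition, branching and iterations whose intermediate results stay of
   polynomial length. *)

From Stdlib Require Import FunctionalExtensionality.
From mathcomp Require Import all_boot all_algebra zify.
Require Import Defs.

Set Implicit Arguments.
Unset Strict Implicit.
Unset Printing Implicit Defensive.

(** * Stack programs *)

(** One bit is compared rather than whole colours because [a], [b], [c] are known when the circuit
    is built: each bit of the chosen node is then a constant, a copy or the negation of a single
    wire, so one gate per bit suffices. Two colours of n bits fill exactly the 2n bits of a node, so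
    the function maps nodes to nodes as Pigeon demands. Loops are coloured too, with no constraint
    on [C(a,a)]; hence the cases where a node coincides with [a] or with the chosen node need
    arguments of their own.

    On the machine side, [polytime] demands halting within the bound on every word, not only on
    encodings. The parsers are therefore total functions, meaningless on malformed words but still
    of controlled length. Numbers are unary throughout, as in the encoding of circuits: adding wire
    numbers is concatenation, and a counter is a word consumed bit by bit. Totality of Ward-Szabó is
    inherited from Pigeon through the reduction. *)

Definition store := nat -> bits.

Definition upd (s : store) (i : nat) (x : bits) : store :=
  fun j => if j == i then x else s j.

Arguments upd : simpl never.

(** [Branch] computes its target from the top bit of a register ([None] on an empty one) and from
    the current position; the jumps used below are relative, which makes code relocatable. *)
Inductive instr :=
  | Push of nat & bool
  | Pop of nat
  | Branch of nat & (option bool -> nat -> nat).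

Definition instr_reg (a : instr) : nat :=
  match a with Push i _ | Pop i | Branch i _ => i end.

Definition exec (a : instr) (x : nat * store) : nat * store :=
  match a with
  | Push i b => (x.1.+1, upd x.2 i (b :: x.2 i))
  | Pop i => (x.1.+1, upd x.2 i (behead (x.2 i)))
  | Branch i g => (g (ohead (x.2 i)) x.1, x.2)
  end.

Definition mstep (code : seq instr) (x : nat * store) : option (nat * store) :=
  omap (exec^~ x) (onth code x.1).

Fixpoint reach (code : seq instr) (n : nat) (x y : nat * store) : Prop :=
  if n is n'.+1 then exists2 z, mstep code x = Some z & reach code n' z y
  else x = y.

(* [c] is position independent: it may be placed inside any larger program. *)
Definition runs (c : seq instr) (s s' : store) (t : nat) : Prop :=
  forall pre post, exists2 n, n <= t
    & reach (pre ++ c ++ post) n (size pre, s) (size pre + size c, s').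

Lemma updE s i x j : upd s i x j = if j == i then x else s j.
Proof. by []. Qed.

Lemma reach_trans code n1 n2 x y z :
  reach code n1 x y -> reach code n2 y z -> reach code (n1 + n2) x z.
Proof.
elim: n1 x => [|n IH] x /=; first by move=> ->.
by case=> u xu uy yz; exists u => //; apply: IH.
Qed.

Lemma mstep_at pre a post x :
  x.1 = size pre -> mstep (pre ++ a :: post) x = Some (exec a x).
Proof. by rewrite /mstep => ->; rewrite onth_cat ltnn subnn. Qed.

Lemma runs_nil s : runs [::] s s 0.
Proof. by move=> pre post; exists 0; rewrite //= addn0. Qed.

Lemma runs_le c s s' t t' : t <= t' -> runs c s s' t -> runs c s s' t'.
Proof.
by move=> le_t r pre post; have [n le_n ?] := r pre post; exists n => //; lia.
Qed.

Lemma runs_cat c1 c2 s s1 s2 t1 t2 :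
  runs c1 s s1 t1 -> runs c2 s1 s2 t2 -> runs (c1 ++ c2) s s2 (t1 + t2).
Proof.
move=> r1 r2 pre post.
have [n1 le1 x1] := r1 pre (c2 ++ post).
have [n2 le2 x2] := r2 (pre ++ c1) post.
exists (n1 + n2); first lia.
rewrite size_cat addnA -size_cat -catA.
apply: (reach_trans x1); move: x2.
by rewrite -catA !size_cat.
Qed.

Lemma runs_push i b s : runs [:: Push i b] s (upd s i (b :: s i)) 1.
Proof.
move=> pre post; exists 1 => //=; rewrite mstep_at //=.
by eexists; [reflexivity|rewrite addn1].
Qed.

Lemma runs_pop i s : runs [:: Pop i] s (upd s i (behead (s i))) 1.
Proof.
move=> pre post; exists 1 => //=; rewrite mstep_at //=.
by eexists; [reflexivity|rewrite addn1].
Qed.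

(** The second [Branch] is an unconditional jump from the end of [ct] over [ce]; the offset
    [(size ct).+2] steps over the test and that jump. *)
Definition ifc (i : nat) (q : option bool -> bool) (ct ce : seq instr) :=
  Branch i (fun o pc => pc + if q o then 1 else (size ct).+2) ::
  ct ++ Branch i (fun _ pc => pc + (size ce).+1) :: ce.

Lemma runs_if i q ct ce s s' t :
  runs (if q (ohead (s i)) then ct else ce) s s' t ->
  runs (ifc i q ct ce) s s' t.+2.
Proof.
move=> r pre post; rewrite /ifc.
case: ifP r => qi r.
  have [n le_n x] := r
    (rcons pre (Branch i (fun o pc => pc + if q o then 1 else (size ct).+2)))
    (Branch i (fun _ pc => pc + (size ce).+1) :: ce ++ post).
  exists (1 + (n + 1)); first by lia.
  apply: (@reach_trans _ _ _ _ (size pre + 1, s)).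
    by rewrite /= mstep_at //=; eexists; [reflexivity|rewrite qi].
  rewrite cat_rcons size_rcons in x; rewrite (addn1 (size pre)) /= -catA /=.
  apply: (reach_trans x) => /=.
  rewrite -cat_cons catA mstep_at /=; last by rewrite size_cat /=; lia.
  eexists; first reflexivity.
  by rewrite /= !size_cat /=; congr (_, _); lia.
have [n le_n x] := r
  (pre ++ (Branch i (fun o pc => pc + if q o then 1 else (size ct).+2))
   :: ct ++ [:: (Branch i (fun _ pc => pc + (size ce).+1))]) post.
exists (1 + n); first by lia.
apply: (@reach_trans _ _ _ _ (size pre + (size ct).+2, s)).
  by rewrite /= mstep_at //=; eexists; [reflexivity|rewrite qi].
move: x; rewrite !size_cat /= !size_cat /= -!catA /= -!catA /=.
have -> : size pre + (size ct + 1).+1 = size pre + (size ct).+2 by lia.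
have -> : size pre + (size ct).+2 + size ce =
  size pre + (size ct + (size ce).+1).+1 by lia.
by [].
Qed.

(** The closing jump stands [(size c).+1] places after the test, so the truncated subtraction is
    exact. *)
Definition whilec (i : nat) (c : seq instr) :=
  Branch i (fun o pc => pc + if o then 1 else (size c).+2) ::
  c ++ [:: Branch i (fun _ pc => pc - (size c).+1)].

Lemma runs_while_end i c s : s i = [::] -> runs (whilec i c) s s 1.
Proof.
move=> si pre post; exists 1 => //=; rewrite mstep_at //=.
eexists; first reflexivity.
by rewrite si /= size_cat /=; congr (_, _); lia.
Qed.

Lemma runs_while_step i c s s1 s2 t t' :
  s i <> [::] -> runs c s s1 t -> runs (whilec i c) s1 s2 t' ->
  runs (whilec i c) s s2 (t + t').+2.
Proof.
move=> si r r' pre post; have [n' le_n' x'] := r' pre post.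
have [n le_n x] := r
  (rcons pre (Branch i (fun o pc => pc + if o then 1 else (size c).+2)))
  (Branch i (fun _ pc => pc - (size c).+1) :: post).
exists (1 + (n + (1 + n'))); first lia.
apply: (@reach_trans _ _ _ _ (size pre + 1, s)).
  rewrite /= mstep_at //=; eexists; first reflexivity.
  by case: (s i) si.
move: x; rewrite cat_rcons size_rcons (addn1 (size pre)) /= -catA /= => x.
apply: (reach_trans x) => /=.
rewrite -cat_cons catA mstep_at /=; last by rewrite size_cat /=; lia.
eexists; first reflexivity.
move: x'; rewrite /= -!catA /=.
by have -> : (size pre).+1 + size c - (size c).+1 = size pre by lia.
Qed.

(** [Push] writes a constant bit, hence the two arms. Pouring reverses the word; a second pour
    restores its order in [movec] and [copyc]. *)
Definition pour (i : nat) (js : seq nat) :=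
  whilec i (ifc i (pred1 (Some true))
    (Pop i :: [seq Push j true | j <- js])
    (Pop i :: [seq Push j false | j <- js])).

Definition clearc i := pour i [::].

Lemma runs_pushes js b s : uniq js ->
  runs [seq Push j b | j <- js] s
    (fun k => if k \in js then b :: s k else s k) (size js).
Proof.
elim: js s => [|j js IH] s /=.
  by move=> _; exact: runs_nil.
case/andP=> jn un; have := runs_cat (runs_push j b s) (IH (upd s j (b :: s j)) un).
rewrite /= add1n; congr runs; apply: functional_extensionality => k.
rewrite inE /upd; case: eqP => [->|] //=.
by rewrite (negbTE jn).
Qed.

(** Each bit costs one pop, [size js] pushes, two steps for the conditional and two for the loop,
    whence the factor [size js + 5]; the final [.+1] is the failing test. *)
Lemma runs_pour i js s : uniq js -> i \notin js ->
  runs (pour i js) s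
    (fun k => if k == i then [::] else if k \in js then catrev (s i) (s k) else s k)
    ((size js + 5) * size (s i)).+1.
Proof.
move=> un ni; move E : (s i) => l.
elim: l s E => [|b l IH] s E.
  rewrite muln0; have := runs_while_end (ifc i (pred1 (Some true))
    (Pop i :: [seq Push j true | j <- js])
    (Pop i :: [seq Push j false | j <- js])) E.
  rewrite /pour; congr runs; apply: functional_extensionality => k.
  by case: eqP => [->|] //=; rewrite if_same.
set s1 : store := fun k => if k == i then l else if k \in js then b :: s k else s k.
have r1 : runs (Pop i :: [seq Push j b | j <- js]) s s1 (1 + size js).
  have := runs_cat (runs_pop i s) (runs_pushes b (upd s i (behead (s i))) un).
  congr runs; apply: functional_extensionality => k.
  rewrite /s1 /upd; case: eqP => [->|] //.
  by rewrite (negbTE ni) E.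
have r2 : runs (ifc i (pred1 (Some true))
    (Pop i :: [seq Push j true | j <- js])
    (Pop i :: [seq Push j false | j <- js])) s s1 (1 + size js).+2.
  by apply: runs_if; rewrite E /=; case: (b) r1.
have E1 : s1 i = l by rewrite /s1 eqxx.
have := runs_while_step _ r2 (IH _ E1).
rewrite E => /(_ ltac:(by [])) r3.
apply: (@runs_le _ _ _ ((1 + size js).+2 + ((size js + 5) * size l).+1).+2).
  by rewrite /= mulnS; lia.
move: r3; congr runs; apply: functional_extensionality => k.
by rewrite /s1; case: eqP => // _; case: ifP => // kj; rewrite ?kj.
Qed.

Lemma runs_clear i s : runs (clearc i) s (upd s i [::]) (5 * size (s i)).+1.
Proof.
by have := @runs_pour i [::] s; rewrite /clearc => /(_ isT isT).
Qed.

Definition movec i j tmp := clearc j ++ pour i [:: tmp] ++ pour tmp [:: j].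

Lemma runs_move i j tmp s : i != j -> i != tmp -> j != tmp -> s tmp = [::] ->
  runs (movec i j tmp) s (upd (upd s i [::]) j (s i))
    (12 * size (s i) + 5 * size (s j) + 3).
Proof.
move=> ij it jt st.
have r1 := runs_clear j s.
have r2 := @runs_pour i [:: tmp] (upd s j [::]) isT.
rewrite inE it in r2; have {}r2 := r2 isT.
set s2 : store := (fun k => _) in r2.
have r3 := @runs_pour tmp [:: j] s2 isT.
rewrite inE eq_sym jt in r3; have {}r3 := r3 isT.
have r := runs_cat r1 (runs_cat r2 r3).
have s2t : s2 tmp = rev (s i).
  by rewrite /s2 eq_sym (negbTE it) inE eqxx /upd (negbTE ij) eq_sym (negbTE jt) st.
rewrite /upd (negbTE ij) s2t size_rev /= in r.
apply: runs_le (_ : _ <= _) _; last first.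
  move: r; congr runs; apply: functional_extensionality => k.
  rewrite /upd; case: (eqVneq k tmp) => [->|kt].
    by rewrite eq_sym (negbTE jt) eq_sym (negbTE it).
  rewrite inE; case: eqP => [->|/eqP kj].
    rewrite -/(rev (rev (s i))) -/(rev _) /s2 eq_sym (negbTE ij) inE (negbTE jt) /upd eqxx.
    by rewrite catrevE cats0 revK.
  by rewrite /s2 inE (negbTE kt) /upd (negbTE kj).
lia.
Qed.

Definition copyc i j tmp := pour i [:: tmp] ++ pour tmp [:: i; j].

Lemma runs_copy i j tmp s : i != j -> i != tmp -> j != tmp -> s tmp = [::] ->
  s j = [::] ->
  runs (copyc i j tmp) s (upd s j (s i)) (13 * size (s i) + 2).
Proof.
move=> ij it jt st sj.
have r2 := @runs_pour i [:: tmp] s isT.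
rewrite inE it in r2; have {}r2 := r2 isT.
set s2 : store := (fun k => _) in r2.
have r3 := @runs_pour tmp [:: i; j] s2.
rewrite /= !inE ij eq_sym (negbTE it) eq_sym (negbTE jt) in r3; have {}r3 := r3 isT isT.
have r := runs_cat r2 r3.
have s2t : s2 tmp = rev (s i).
  by rewrite /s2 eq_sym (negbTE it) inE eqxx st.
rewrite s2t size_rev /= in r.
apply: runs_le (_ : _ <= _) _; last first.
  move: r; congr runs; apply: functional_extensionality => k.
  rewrite /upd; case: (eqVneq k tmp) => [->|kt].
    by rewrite eq_sym (negbTE jt) st.
  rewrite !inE /s2 inE (negbTE kt).
  case: (eqVneq k i) => [->|ki] /=.
    by rewrite (negbTE ij) catrevE cats0 revK.
  by case: eqP => [->|//]; rewrite catrevE revK sj cats0.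
lia.
Qed.

(** An instruction lengthens a register by at most one bit. This makes running time a bound on the
    length of results. *)
Lemma size_reach code n x y i :
  reach code n x y -> size (y.2 i) <= size (x.2 i) + n.
Proof.
elim: n x => [|n IH] x /=; first by move=> ->; rewrite addn0.
case=> z xz /IH {IH}; move: xz; rewrite /mstep; case: onth => //= a [<-].
suff : size ((exec a x).2 i) <= (size (x.2 i)).+1 by lia.
case: a => [j b|j|j g] //=; rewrite ?/upd; first by case: eqP => [->|].
by case: eqP => [->|]; rewrite ?size_behead; lia.
Qed.

Lemma size_runs c s s' t i : runs c s s' t -> size (s' i) <= size (s i) + t.
Proof.
move=> /(_ [::] [::])[n le_n] /(size_reach i) /=; lia.
Qed.

(** * Simulation of a stack program by a Turing machine *)

Lemma all_onth (A : Type) (q : pred A) (s : seq A) i a :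
  all q s -> onth s i = Some a -> q a.
Proof. by elim: s i => [|b s IH] [|i] //= /andP[? ?] //; [case=> <-|apply: IH]. Qed.

Definition bit_symbol (b : bool) : symbol void := Some (inl b).

Definition symbol_bit (s : symbol void) : option bool :=
  if s is Some (inl b) then Some b else None.

Section Machine.
Variables (code : seq instr) (k : nat).

(* A push takes two machine steps: one left, then one to write.  The boolean of
   the state tells whether the first of them has been made. *)
Definition stack_transition (q : 'I_(size code).+1 * bool)
    (r : {ffun 'I_k -> symbol void}) :
    option ('I_(size code).+1 * bool * {ffun 'I_k -> symbol void * move}) :=
  match onth code q.1 with
  | None => None
  | Some (Push i b) =>
      if q.2 then
        Some ((inord q.1.+1, false),
              [ffun j : 'I_k => (if j == i :> nat then bit_symbol b else r j, Stay)])
      else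
        Some ((q.1, true),
              [ffun j : 'I_k => (r j, if j == i :> nat then MoveLeft else Stay)])
  | Some (Pop i) =>
      Some ((inord q.1.+1, false),
            [ffun j : 'I_k => (r j, if j == i :> nat then MoveRight else Stay)])
  | Some (Branch i g) =>
      Some ((inord (g (obind (fun j => symbol_bit (r j)) (insub i)) q.1), false),
            [ffun j : 'I_k => (r j, Stay)])
  end.

Definition stack_machine : TM k :=
  @MkTM k ('I_(size code).+1 * bool)%type void (ord0, false) stack_transition.

(** [left_part] is left free: popped bits stay there until a push overwrites them. The trailing
    blanks are cells beyond the bottom of the stack that a head has visited. *)
Definition holds_stack (t : tape void) (x : bits) : Prop :=
  exists n, right_part t = map bit_symbol x ++ nseq n None.

Definition simulates (c : config stack_machine) (x : nat * store) : Prop :=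
  cfg_state c = (inord x.1, false) /\
  forall j : 'I_k, holds_stack (cfg_tapes c j) (x.2 j).

Lemma read_stack t x : holds_stack t x -> symbol_bit (read t) = ohead x.
Proof. by case=> n; rewrite /read => ->; case: x => [|b x] //=; case: n. Qed.

Lemma write_read_stack t x : holds_stack t x -> holds_stack (write (read t) t) x.
Proof.
case: t => l r [n /= e]; rewrite /holds_stack /write /read /= e.
case: x {e} => [|b x] /=; last by exists n.
by case: n => [|n]; [exists 1|exists n.+1].
Qed.

Lemma pop_stack t x : holds_stack t x ->
  holds_stack (shift MoveRight (write (read t) t)) (behead x).
Proof.
case: t => l r [n /= e]; rewrite /holds_stack /write /read /= e.
by case: x {e} => [|b x] /=; [exists n.-1; case: n|exists n].
Qed.

Lemma push_stack t x b : holds_stack t x ->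
  holds_stack (write (bit_symbol b) (shift MoveLeft (write (read t) t))) (b :: x).
Proof.
by move/write_read_stack => [n e]; exists n; rewrite /= -e.
Qed.

Lemma run_le (c d : config stack_machine) t t' :
  t <= t' -> run t c = Some d -> run t' c = Some d.
Proof.
elim: t t' c => [|t IH] [|t'] c //=; case: step => // c' le_t; exact: IH.
Qed.

(** Only a push needs both steps; for the other instructions one machine step is made and [run_le]
    supplies the slack, so that the cost is uniform. *)
Lemma simulate_step (c : config stack_machine) x y :
  all (fun a => instr_reg a < k) code -> simulates c x ->
  x.1 <= size code ->
  mstep code x = Some y -> y.1 <= size code ->
  exists2 c', simulates c' y
    & forall t d, run t c' = Some d -> run t.+2 c = Some d.
Proof.
case: c x => [q ts] [pc s] /= reg [/= -> st] lt_pc.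
rewrite /mstep /=; case E: (onth code pc) => [a|] //= [<-] {y}.
have ar : instr_reg a < k := all_onth reg E.
have pcE : nat_of_ord (inord pc : 'I_(size code).+1) = pc by rewrite inordK.
case: a ar E => [i b|i|i g] /= ar E le_y.
- exists (MkConfig (M := stack_machine) (inord pc.+1, false)
    [ffun j : 'I_k => if j == i :> nat then
       write (bit_symbol b) (shift MoveLeft (write (read (ts j)) (ts j)))
     else write (read (ts j)) (write (read (ts j)) (ts j))]).
    split=> //= j; rewrite ffunE /upd; case: eqP => [<-|_]; first exact: push_stack.
    exact/write_read_stack/write_read_stack.
  move=> t d rt /=.
  rewrite {1}/step /= /stack_transition /= pcE E /=.
  rewrite {1}/step /= /stack_transition /= pcE E /=.
  rewrite -rt; congr (run t (MkConfig _ _)).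
  apply/ffunP => j; rewrite !ffunE /=; case: eqP => [e|ne] //=.
- exists (MkConfig (M := stack_machine) (inord pc.+1, false)
    [ffun j : 'I_k => if j == i :> nat then
       shift MoveRight (write (read (ts j)) (ts j))
     else write (read (ts j)) (ts j)]).
    split=> //= j; rewrite ffunE /upd; case: eqP => [<-|_]; first exact: pop_stack.
    exact/write_read_stack.
  move=> t d rt;
  apply: (@run_le (MkConfig (M := stack_machine) (inord pc, false) ts) _
    t.+1 t.+2) => //.
  rewrite /= {1}/step /= /stack_transition /= pcE E /=.
  rewrite -rt; congr (run t (MkConfig _ _)).
  by apply/ffunP => j; rewrite !ffunE /=; case: eqP.
- exists (MkConfig (M := stack_machine) (inord (g (ohead (s i)) pc), false)
    [ffun j : 'I_k => write (read (ts j)) (ts j)]).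
    split=> //= j; rewrite ffunE; exact/write_read_stack.
  move=> t d rt;
  apply: (@run_le (MkConfig (M := stack_machine) (inord pc, false) ts) _
    t.+1 t.+2) => //.
  rewrite /= {1}/step /= /stack_transition /= pcE E /=.
  rewrite (insubT (fun i => i < k) ar) /= ffunE (read_stack (st _)) /=.
  rewrite -rt; congr (run t (MkConfig _ _)).
  by apply/ffunP => j; rewrite !ffunE /=.
Qed.

Lemma simulate_reach (c : config stack_machine) x n s :
  all (fun a => instr_reg a < k) code -> simulates c x ->
  x.1 <= size code ->
  reach code n x (size code, s) ->
  exists2 d, run n.*2 c = Some d & simulates d (size code, s).
Proof.
move=> reg; elim: n c x => [|n IH] c x sim le_x /=.
  move=> ex; exists c; last by rewrite -ex.
  case: c sim => q ts; rewrite ex => -[/= -> _]; rewrite /step /=.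
  (* No instruction stands at position [size code], so the machine halts there. *)
  by rewrite /stack_transition /= inordK // onth_default.
(* An intermediate position carries an instruction, since another step follows; the last one is
   [size code]. So [inord] never truncates a position reached. *)
case=> y xy yn; have le_y : y.1 <= size code.
  case: n yn {IH} => [->|n] //= [z + _]; rewrite /mstep.
  by case E: onth => [a|] // _; apply: ltnW; rewrite -onthTE E.
have [c' sim' rc] := simulate_step reg sim le_x xy le_y.
have [d rd simd] := IH c' y sim' le_y yn.
by exists d => //; apply: rc.
Qed.

Lemma holds_stack_output t x : holds_stack t x -> tape_output t = x.
Proof.
case=> n; rewrite /tape_output => ->; elim: x => [|b x IH] /=; first by case: n.
by rewrite IH.
Qed.

End Machine.

(** Register [m + k] is the last tape, that of [ord_max]. The polynomial is doubled in the proof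
    because every instruction is granted two machine steps. *)
Lemma polytime_runs m k (F : m.-tuple bits -> bits) (code : seq instr)
    (time : m.-tuple bits -> nat) (p : {poly nat}) :
  all (fun a => instr_reg a < (m + k).+1) code ->
  (forall xs : m.-tuple bits,
     time xs <= p.[sumn [seq size x | x <- xs]]%R) ->
  (forall xs : m.-tuple bits, exists2 s, s (m + k) = F xs
     & runs code (nth [::] xs) s (time xs)) ->
  polytime F.
Proof.
move=> reg le_p run_code.
exists k, (stack_machine code (m + k).+1), (p + p)%R => xs.
have [s sF /(_ [::] [::])[n le_n]] := run_code xs.
rewrite cats0 /= add0n => r.
have [| |d rd [_ simd]] := @simulate_reach code (m + k).+1
  (init_config (stack_machine code (m + k).+1) xs) _ _ _ reg _ _ r; last 1 first.
- exists d; last by rewrite (holds_stack_output (simd ord_max)).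
  apply: run_le rd; rewrite hornerD -addnn.
  by apply: leq_add; apply: leq_trans le_n (le_p xs).
- split=> /=; first by rewrite -[ord0]inord_val.
  by move=> j; rewrite ffunE; exists 0; rewrite cats0.
- by [].
Qed.

(** * Functions computable in polynomial time *)

(** With a base of at least 2, powers are positive and bound constants, and a sum of two powers is
    at most twice their product, where the factor 2 costs one more exponent. *)
Definition pbounded (T : Type) (v f : T -> nat) : Prop :=
  exists k, forall t, f t <= (v t + 2) ^ k.

Lemma pbounded_le T (v f g : T -> nat) :
  (forall t, f t <= g t) -> pbounded v g -> pbounded v f.
Proof. by move=> le_fg [k gk]; exists k => t; apply: leq_trans (gk t). Qed.

Lemma pbounded_const T (v : T -> nat) c : pbounded v (fun=> c).
Proof.
exists c => t; apply: (@leq_trans (2 ^ c)); first exact/ltnW/ltn_expl.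
by case: c => // c; rewrite leq_exp2r //; lia.
Qed.

Lemma pbounded_self T (v : T -> nat) : pbounded v v.
Proof. by exists 1 => t; rewrite expn1; lia. Qed.

Lemma pbounded_mul T (v f g : T -> nat) :
  pbounded v f -> pbounded v g -> pbounded v (fun t => f t * g t).
Proof.
by case=> k fk [l gl]; exists (k + l) => t; rewrite expnD; apply: leq_mul.
Qed.

Lemma pbounded_add T (v f g : T -> nat) :
  pbounded v f -> pbounded v g -> pbounded v (fun t => f t + g t).
Proof.
case=> k fk [l gl]; exists (k + l).+1 => t; rewrite expnS expnD.
have := fk t; have := gl t; set x := v t + 2.
have : 0 < x ^ k by rewrite expn_gt0 /x; lia.
have : 0 < x ^ l by rewrite expn_gt0 /x; lia.
have : 2 <= x by rewrite /x; lia.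
move: (x ^ k) (x ^ l) => y z x2 z0 y0 gz fy.
apply: (@leq_trans (2 * (y * z))); last by apply: leq_mul.
by nia.
Qed.

Lemma pbounded_trans T (v w f : T -> nat) :
  pbounded v w -> pbounded w f -> pbounded v f.
Proof.
(* With [x = v t + 2], [w t + 2 <= 4 * x ^ k <= x ^ k.+2], whence the exponent. *)
case=> k wk [l fl]; exists (k.+2 * l) => t; apply: leq_trans (fl t) _.
rewrite expnM; case: l {fl} => [|l]; first by rewrite !expn0.
rewrite leq_exp2r // !expnS; have := wk t; set x := v t + 2.
have : 0 < x ^ k by rewrite expn_gt0 /x; lia.
have : 2 <= x by rewrite /x; lia.
move: (x ^ k) => y x2 y0 wy; rewrite mulnA.
by apply: (@leq_trans (2 * 2 * y)); [lia|apply/leq_mul/leqnn/leq_mul].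
Qed.

Lemma pbounded_comp T U (h : U -> T) (v f : T -> nat) :
  pbounded v f -> pbounded (v \o h) (f \o h).
Proof. by case=> k fk; exists k => u; apply: fk. Qed.

Ltac solve_pbounded := repeat first
  [ eassumption | exact: pbounded_self | exact: pbounded_const
  | apply: pbounded_add | apply: pbounded_mul ].

Definition total_size (T : Type) (vars : seq (T -> bits)) (t : T) : nat :=
  sumn [seq size (v t) | v <- vars].

(* [ptime vars F]: from the values of [vars] at [t], held in any given
   registers, [F t] can be computed into the first free register [d] within a
   time polynomial in the lengths of these values. *)
Definition ptime (T : Type) (vars : seq (T -> bits)) (F : T -> bits) : Prop :=
  forall (regs : seq nat) (d : nat),
    size regs = size vars -> all (fun i => i < d) regs ->
  exists (c : seq instr) (time : T -> nat),
    pbounded (total_size vars) time /\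
    forall t (s : store),
      [seq s i | i <- regs] = [seq v t | v <- vars] ->
      (forall j, d <= j -> s j = [::]) ->
      runs c s (upd s d (F t)) (time t).

Lemma eqn_addr (d m : nat) : (d + m == d) = (m == 0).
Proof. by rewrite -{2}[d]addn0 eqn_add2l. Qed.

Lemma eqn_addl (d m : nat) : (d == d + m) = (m == 0).
Proof. by rewrite eq_sym eqn_addr. Qed.

Lemma eqn_far j d m : j < d -> (j == d + m) = false.
Proof. by move=> lt_j; apply/eqP; lia. Qed.

Definition eqn_offset := (eqn_addr, eqn_addl, eqn_add2l).

(** Stores that differ by updates at small offsets from [d] are compared register by register: those
    below [d] are untouched, and the layouts in use reach at most offset 5. *)
Ltac store_ext d :=
  let j := fresh "j" in let m := fresh "m" in let lt_j := fresh "lt_j" in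
  apply: functional_extensionality => j; rewrite /upd; have [lt_j|] := ltnP j d;
  [ by rewrite ?(ltn_eqF lt_j, eqn_far _ lt_j)
  | move/subnKC => <-; move: (j - d) => m; rewrite !eqn_offset;
    do 6?(case: m => [|m] //=) ].

Definition ptimeb T (vars : seq (T -> bits)) (b : T -> bool) : Prop :=
  ptime vars (fun t => [:: b t]).

Section Ptime.
Variable T : Type.
Implicit Types (vars : seq (T -> bits)) (F G C : T -> bits).

Lemma ptime_ext vars F G : F =1 G -> ptime vars F -> ptime vars G.
Proof. by move=> /functional_extensionality ->. Qed.

(** A program writes its result bit by bit into an empty register, so its time bound also bounds the
    length of the result. *)
Lemma ptime_size vars F :
  ptime vars F -> pbounded (total_size vars) (fun t => size (F t)).
Proof.
move=> /(_ (iota 0 (size vars)) (size vars)) [||c [time [pt rc]]].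
- by rewrite size_iota.
- by apply/allP => i; rewrite mem_iota.
apply: pbounded_le pt => t.
set s : store := fun j => nth [::] [seq v t | v <- vars] j.
have /(size_runs (size vars)) : runs c s (upd s (size vars) (F t)) (time t).
  apply: rc => [|j le_j]; last by rewrite /s nth_default ?size_map.
  by rewrite map_nth_iota0 ?size_map // take_oversize ?size_map.
by rewrite updE eqxx /s nth_default ?size_map.
Qed.

Lemma size_nth_total_size vars i t :
  size (nth (fun=> [::]) vars i t) <= total_size vars t.
Proof.
rewrite /total_size; elim: vars i => [|v vars IH] [|i] //=; first by rewrite leq_addr.
exact: leq_trans (IH i) (leq_addl _ _).
Qed.

Lemma upd_id s i x : s i = x -> upd s i x = s.
Proof.
by move=> <-; apply: functional_extensionality => j; rewrite /upd; case: eqP => [->|].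
Qed.

Lemma upd_upd s i x y : upd (upd s i x) i y = upd s i y.
Proof. by apply: functional_extensionality => j; rewrite /upd; case: eqP. Qed.

Lemma ptime_var i vars : i < size vars -> ptime vars (nth (fun=> [::]) vars i).
Proof.
move=> lt_i regs d sz lt_regs.
exists (copyc (nth 0 regs i) d d.+1), (fun t => 13 * total_size vars t + 2); split.
  by solve_pbounded.
move=> t s e0 s0.
have lt_r : nth 0 regs i < d by apply: (all_nthP 0 lt_regs); rewrite sz.
have <- : s (nth 0 regs i) = nth (fun=> [::]) vars i t.
  have /(congr1 (fun l => nth [::] l i)) := e0.
  by rewrite (nth_map 0) ?sz // (nth_map (fun=> [::])).
have := @runs_copy (nth 0 regs i) d d.+1 s.
rewrite (s0 d.+1) // (s0 d) // !neq_ltn lt_r (ltnS _ d) (ltnW lt_r) leqnn.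
move=> /(_ isT isT isT erefl erefl); apply: runs_le.
have -> : s (nth 0 regs i) = nth (fun=> [::]) vars i t.
  have /(congr1 (fun l => nth [::] l i)) := e0.
  by rewrite (nth_map 0) ?sz // (nth_map (fun=> [::])).
by have := size_nth_total_size vars i t; lia.
Qed.

Lemma ptime_nil vars : ptime vars (fun=> [::]).
Proof.
move=> regs d _ _; exists [::], (fun=> 0); split; first by solve_pbounded.
by move=> t s _ s0; rewrite upd_id ?s0 //; apply: runs_nil.
Qed.

Lemma ptime_cons vars b F : ptime vars F -> ptime vars (fun t => b :: F t).
Proof.
move=> pF regs d sz lt; have [c [time [pt rc]]] := pF regs d sz lt.
exists (c ++ [:: Push d b]), (fun t => time t + 1); split; first by solve_pbounded.
move=> t s e0 s0; have := runs_cat (rc t s e0 s0) (runs_push d b _).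
by rewrite upd_upd updE eqxx.
Qed.

Lemma ptime_behead vars F : ptime vars F -> ptime vars (fun t => behead (F t)).
Proof.
move=> pF regs d sz lt; have [c [time [pt rc]]] := pF regs d sz lt.
exists (c ++ [:: Pop d]), (fun t => time t + 1); split; first by solve_pbounded.
move=> t s e0 s0; have := runs_cat (rc t s e0 s0) (runs_pop d _).
by rewrite upd_upd updE eqxx.
Qed.

(** The condition is computed in [d] itself, so each arm begins by clearing [d] in order to find the
    free registers empty; the sum of the times of both arms bounds either. *)
Lemma ptime_branch vars (q : option bool -> bool) C F G :
  ptime vars C -> ptime vars F -> ptime vars G ->
  ptime vars (fun t => if q (ohead (C t)) then F t else G t).
Proof.
move=> pC pF pG regs d sz lt.
have pz := ptime_size pC.
have [cC [tC [ptC rC]]] := pC regs d sz lt.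
have [cF [tF [ptF rF]]] := pF regs d sz lt.
have [cG [tG [ptG rG]]] := pG regs d sz lt.
exists (cC ++ ifc d q (clearc d ++ cF) (clearc d ++ cG)),
  (fun t => tC t + (5 * size (C t) + 1 + (tF t + tG t) + 2)).
split; first by solve_pbounded.
move=> t s e0 s0; apply: runs_cat (rC t s e0 s0) _.
rewrite addn2; apply: runs_if; rewrite updE eqxx.
have rcl := runs_clear d (upd s d (C t)).
rewrite upd_upd updE eqxx (upd_id (s0 d (leqnn d))) in rcl.
case: ifP => _.
  by apply: (runs_le _ (runs_cat rcl (rF t s e0 s0))); lia.
by apply: (runs_le _ (runs_cat rcl (rG t s e0 s0))); lia.
Qed.

Lemma map_upd s d x regs : all (fun i => i < d) regs ->
  [seq upd s d x i | i <- regs] = [seq s i | i <- regs].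
Proof.
move=> /allP lt; apply/eq_in_map => i /lt lt_i.
by rewrite /upd; case: eqP lt_i => [->|//]; rewrite ltnn.
Qed.

(** A local definition: [G] is left in [d] as one more argument, [F] is computed in [d + 1], then
    moved onto [d]. The time for [F] is polynomial in the size of [G t] as well, which [ptime_size]
    bounds in turn. *)
Lemma ptime_cut vars G F :
  ptime vars G -> ptime (G :: vars) F -> ptime vars F.
Proof.
move=> pG pF regs d sz lt.
have pzG := ptime_size pG; have pzF := ptime_size pF.
have [cG [tG [ptG rG]]] := pG regs d sz lt.
have ltS : all (fun i => i < d + 1) (d :: regs).
  by rewrite /= addn1 ltnSn; apply: sub_all lt => i /ltnW.
have [cF [tF [ptF rF]]] := pF (d :: regs) (d + 1) (congr1 S sz) ltS.
have pv : pbounded (total_size vars) (total_size (G :: vars)).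
  by rewrite /total_size /=; solve_pbounded.
have {}ptF := pbounded_trans pv ptF; have {}pzF := pbounded_trans pv pzF.
exists (cG ++ cF ++ movec (d + 1) d (d + 2)),
  (fun t => tG t + (tF t + (12 * size (F t) + 5 * size (G t) + 3))).
split; first by solve_pbounded.
move=> t s e0 s0; apply: (runs_cat (rG t s e0 s0)).
apply: (runs_cat (rF t _ _ _)).
- by rewrite /= updE eqxx map_upd // e0.
- move=> j lt_j; rewrite updE s0; last by lia.
  by have -> : (j == d) = false by apply/eqP; lia.
have := @runs_move (d + 1) d (d + 2) (upd (upd s d (G t)) (d + 1) (F t)).
rewrite !updE !eqn_offset /= (s0 (d + 2)) ?leq_addr // => /(_ isT isT isT erefl).
by congr runs; [store_ext d; rewrite (s0 (d + 1)) ?leq_addr|rewrite eqxx].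
Qed.

(** Indices in [idx] may repeat, so the total size of [vars] is bounded by [size idx] times that of
    [vars']. *)
Lemma ptime_weak (idx : seq nat) vars vars' F :
  all (fun i => i < size vars') idx ->
  vars = [seq nth (fun=> [::]) vars' i | i <- idx] ->
  ptime vars F -> ptime vars' F.
Proof.
move=> lt_idx e pF regs d sz lt.
have sz' : size [seq nth 0 regs i | i <- idx] = size vars.
  by rewrite e !size_map.
have lt' : all (fun i => i < d) [seq nth 0 regs i | i <- idx].
  rewrite all_map; apply: sub_all lt_idx => i /= lt_i.
  by apply: (all_nthP 0 lt); rewrite sz.
have [c [time [pt rc]]] := pF _ d sz' lt'.
exists c, time; split.
  apply: pbounded_trans pt;
  apply: (@pbounded_le _ _ _ (fun t => size idx * total_size vars' t)).
    move=> t; rewrite e /total_size -map_comp; elim: (idx) => //= i l IH.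
    by rewrite mulSn leq_add // size_nth_total_size.
  by solve_pbounded.
move=> t s e0 s0; apply: rc => //; rewrite e -!map_comp.
apply/eq_in_map => i /(allP lt_idx) lt_i /=.
have /(congr1 (fun l => nth [::] l i)) := e0.
by rewrite (nth_map 0) ?sz // (nth_map (fun=> [::])).
Qed.

Lemma ptime_weak1 vars G F : ptime vars F -> ptime (G :: vars) F.
Proof.
apply: (@ptime_weak (iota 1 (size vars))).
  by apply/allP => i; rewrite mem_iota /= add1n => /andP[].
by rewrite -[1]/(1 + 0) iotaDl -map_comp /= -[LHS](mkseq_nth (fun=> [::])).
Qed.

Lemma ptime_catl us vars F : ptime us F -> ptime (us ++ vars) F.
Proof.
apply: (@ptime_weak (iota 0 (size us))).
  by apply/allP => i; rewrite mem_iota /= size_cat; lia.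
rewrite -[LHS](mkseq_nth (fun=> [::])); apply/eq_in_map => i.
by rewrite mem_iota /= nth_cat add0n => ->.
Qed.

End Ptime.

(** A program sees only the values held in registers, so the parameter can be reindexed freely. *)
Lemma ptime_map T U (h : U -> T) (vars : seq (T -> bits)) F :
  ptime vars F -> ptime [seq v \o h | v <- vars] (F \o h).
Proof.
move=> pF regs d sz lt; rewrite size_map in sz.
have [c [time [pt rc]]] := pF regs d sz lt.
exists c, (time \o h); split.
  have /(pbounded_comp h) := pt; apply: pbounded_trans.
  apply: (pbounded_le (g := total_size [seq v \o h | v <- vars])); last by solve_pbounded.
  by move=> u; rewrite /total_size -map_comp.
by move=> u s e0 s0; apply: rc => //; rewrite e0 -map_comp.
Qed.

(** * Iteration on a state of polynomially bounded length *)

Section Iteration.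
Variables (T : Type) (vars : seq (T -> bits)) (clock : T -> bits).
Variables (init : T -> bits * bits) (next : T -> bits * bits -> bits * bits).
Variable bound : T -> nat.

Let vars' : seq (T * (bits * bits) -> bits) :=
  (fun p => p.2.1) :: (fun p => p.2.2) :: [seq (fun p => v p.1) | v <- vars].

Hypothesis clock_ptime : ptime vars clock.
Hypothesis init_ptime1 : ptime vars (fun t => (init t).1).
Hypothesis init_ptime2 : ptime vars (fun t => (init t).2).
Hypothesis next_ptime1 : ptime vars' (fun p => (next p.1 p.2).1).
Hypothesis next_ptime2 : ptime vars' (fun p => (next p.1 p.2).2).
Hypothesis bound_pb : pbounded (total_size vars) bound.
Hypothesis boundP : forall t n (x := iter n (next t) (init t)),
  n <= size (clock t) -> size x.1 + size x.2 <= bound t.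

Lemma total_size_iter_vars t x :
  total_size vars' (t, x) = size x.1 + size x.2 + total_size vars t.
Proof. by rewrite /total_size /= -map_comp addnA. Qed.

(** The time of a round is polynomial in the size of the current state; bounding the state by
    [bound t] makes it polynomial in the parameters alone. *)
Lemma iter_step_bound (time : T * (bits * bits) -> nat) :
  pbounded (total_size vars') time ->
  exists2 g, pbounded (total_size vars) g
    & forall t x, size x.1 + size x.2 <= bound t -> time (t, x) <= g t.
Proof.
case=> k le_k; exists (fun t => (bound t + total_size vars t + 2) ^ k).
  apply: (@pbounded_trans _ _ (fun t => bound t + total_size vars t)).
    by solve_pbounded.
  by exists k.
move=> t x le_x; apply: leq_trans (le_k _) _; rewrite total_size_iter_vars.
by case: k {le_k} => // k; rewrite leq_exp2r //; lia.
Qed.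

(** Register [d] holds the clock, of which each round pops one bit; [d + 1] and [d + 2] hold the
    state. Both new components are computed, in [d + 3] and [d + 4], before either old one is
    overwritten; [d + 5] is scratch space for the moves. *)
Lemma ptime_iter (b : bool) :
  ptime vars (fun t => let x := iter (size (clock t)) (next t) (init t) in
                       if b then x.1 else x.2).
Proof.
move=> regs d sz lt.
have [cC [tC [ptC rC]]] := clock_ptime sz lt.
have ltn m : all (fun i => i < d + m) regs.
  by apply: sub_all lt => i lt_i; lia.
have [c1 [t1 [pt1 r1]]] := init_ptime1 sz (ltn 1).
have [c2 [t2 [pt2 r2]]] := init_ptime2 sz (ltn 2).
pose regs' := d + 1 :: d + 2 :: regs.
have sz' : size regs' = size vars' by rewrite /= size_map sz.
have lt' m : 2 < m -> all (fun i => i < d + m) regs'.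
  by move=> m2; rewrite /= ltn !ltn_add2l (ltnW m2) m2.
have [c1' [t1' [pt1' r1']]] := next_ptime1 sz' (lt' 3 isT).
have [c2' [t2' [pt2' r2']]] := next_ptime2 sz' (lt' 4 isT).
have [g1 pg1 gP1] := iter_step_bound pt1'.
have [g2 pg2 gP2] := iter_step_bound pt2'.
pose body := [:: Pop d] ++ c1' ++ c2' ++ movec (d + 3) (d + 1) (d + 5)
   ++ movec (d + 4) (d + 2) (d + 5).
pose body_time t := 1 + (g1 t + (g2 t + (12 * bound t + 5 * bound t + 3
   + (12 * bound t + 5 * bound t + 3)))).
(* [j0] is the component to be discarded, [j1] the one to be returned. *)
pose j0 := d + if b then 2 else 1; pose j1 := d + if b then 1 else 2.
exists (cC ++ c1 ++ c2 ++ whilec d body ++ clearc j0 ++ movec j1 d (d + 3)),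
  (fun t => tC t + (t1 t + (t2 t + ((size (clock t) * (body_time t + 2) + 1)
   + ((5 * bound t + 1) + (12 * bound t + 3)))))).
split.
  have pcl := ptime_size clock_ptime; rewrite /body_time; solve_pbounded.
move=> t s e0 s0.
pose lay c x : store := upd (upd (upd s d c) (d + 1) x.1) (d + 2) x.2.
have e0' c x (y : bits) :
    [seq upd (lay c x) (d + 3) y i | i <- regs'] = [seq v (t, x) | v <- vars'].
  rewrite /= !updE !eqn_offset /= -map_comp; congr [:: _, _ & _];
    rewrite ?/lay ?updE ?eqn_offset //.
  by rewrite /lay !map_upd // e0.
have e0'' c x : [seq lay c x i | i <- regs'] = [seq v (t, x) | v <- vars'].
  have := e0' c x [::]; rewrite upd_id //.
  by rewrite /lay !updE !eqn_offset /= s0 ?leq_addr.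
have body_runs n c e : n < size (clock t) -> let x := iter n (next t) (init t) in
   runs body (lay (e :: c) x) (lay c (next t x)) (body_time t).
  move=> lt_n x; apply: (runs_cat (s1 := lay c x)).
    have := runs_pop d (lay (e :: c) x); congr runs; rewrite /lay.
    have -> : (upd (upd (upd s d (e :: c)) (d + 1) x.1) (d + 2) x.2) d = e :: c.
      by rewrite !updE !eqn_offset /= eqxx.
    by store_ext d.
  have le_x : size x.1 + size x.2 <= bound t by apply: boundP (ltnW lt_n).
  have le_y : size (next t x).1 + size (next t x).2 <= bound t.
    by have := boundP lt_n; rewrite iterS.
  apply: (runs_cat (s1 := upd (lay c x) (d + 3) (next t x).1)).
    apply: (runs_le (gP1 t x le_x)); apply: (r1' (t, x)) => // j le_j.
    rewrite /lay !updE s0 //; last by lia.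
    by do 3!(case: eqP => [?|_]; first by exfalso; lia).
  apply: (runs_cat (s1 := upd (upd (lay c x) (d + 3) (next t x).1) (d + 4) (next t x).2)).
    apply: (runs_le (gP2 t x le_x)); apply: (r2' (t, x)) => // j le_j.
    rewrite /lay !updE s0 //; last by lia.
    by do 4!(case: eqP => [?|_]; first by exfalso; lia).
  have {}s0 m : s (d + m) = [::] by rewrite s0 // leq_addr.
  set s1 := upd _ (d + 4) _.
  have r := @runs_move (d + 3) (d + 1) (d + 5) s1.
  rewrite /s1 /lay !updE !eqn_offset /= !s0 in r; have {}r := r isT isT isT erefl.
  apply: (runs_cat (runs_le _ r)); first by lia.
  set s2 := upd _ (d + 1) _.
  have r' := @runs_move (d + 4) (d + 2) (d + 5) s2.
  rewrite /s2 /lay !updE !eqn_offset /= !s0 in r'; have {}r' := r' isT isT isT erefl.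
  apply: (@runs_le _ _ _ (12 * size (next t x).2 + 5 * size x.2 + 3)); first by lia.
  move: r'; congr runs; rewrite /lay.
  by store_ext d; rewrite ?s0.
(* After [n] rounds the clock register holds [drop n (clock t)]; the induction is on the number of
   rounds left. *)
have loop n : n <= size (clock t) ->
    runs (whilec d body) (lay (drop n (clock t)) (iter n (next t) (init t)))
      (lay [::] (iter (size (clock t)) (next t) (init t)))
      ((size (clock t) - n) * (body_time t + 2) + 1).
  move E : (size (clock t) - n) => m; elim: m n E => [|m IH] n E le_n.
    have -> : n = size (clock t) by lia.
    rewrite drop_size; apply: runs_while_end.
    by rewrite /lay !updE !eqn_offset /= eqxx.
  have lt_n : n < size (clock t) by lia.
  rewrite (drop_nth true lt_n).
  have {}IH := IH n.+1 _ lt_n; have {}IH := IH ltac:(lia).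
  have := runs_while_step _
    (body_runs n (drop n.+1 (clock t)) (nth true (clock t) n) lt_n) IH.
  rewrite {1}/lay !updE !eqn_offset /= eqxx => /(_ ltac:(by [])).
  by apply: runs_le; rewrite mulSn; lia.
apply: (runs_cat (rC t s e0 s0)).
apply: (runs_cat (r1 t _ _ _)).
- by rewrite map_upd.
- by move=> j lt_j; rewrite updE s0 ?gtn_eqF //; lia.
apply: (runs_cat (r2 t _ _ _)).
- by rewrite !map_upd.
- by move=> j lt_j; rewrite !updE s0 ?gtn_eqF //; lia.
apply: (runs_cat (s1 := lay [::] (iter (size (clock t)) (next t) (init t)))).
  by have := loop 0 (leq0n _); rewrite drop0 subn0.
have := boundP (leqnn (size (clock t))).
move: (iter _ _ _) => x le_x.
have {}s0 m : s (d + m) = [::] by rewrite s0 // leq_addr.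
have rc := runs_clear j0 (lay [::] x).
apply: (runs_cat (runs_le _ rc)).
  by rewrite /lay !updE /j0; case: (b); rewrite !eqn_add2l /=; lia.
have := @runs_move j1 d (d + 3) (upd (lay [::] x) j0 [::]).
have E1 : upd (lay [::] x) j0 [::] j1 = if b then x.1 else x.2.
  by rewrite /lay !updE /j0 /j1; case: (b); rewrite !eqn_add2l.
have E2 : upd (lay [::] x) j0 [::] d = [::].
  by rewrite /lay !updE /j0; case: (b); rewrite !eqn_offset /= eqxx.
have E3 : upd (lay [::] x) j0 [::] (d + 3) = [::].
  by rewrite /lay !updE /j0; case: (b); rewrite !eqn_offset /= s0.
rewrite E1 E2 E3.
have -> : j1 != d by rewrite /j1; case: (b); apply/eqP; lia.
have -> : j1 != d + 3 by rewrite /j1; case: (b); apply/eqP; lia.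
have -> : d != d + 3 by apply/eqP; lia.
move=> /(_ isT isT isT erefl) r.
apply: (@runs_le _ _ _ (12 * size (if b then x.1 else x.2) + 5 * 0 + 3)).
  by case: (b); lia.
move: r; congr runs; rewrite /lay /j0 /j1.
have sd := s0 0; rewrite addn0 in sd.
by case: (b); store_ext d; rewrite ?s0 ?sd.
Qed.

End Iteration.

(** * Composition, Boolean tests and proof search *)

Definition all_ptime T (vars ws : seq (T -> bits)) : Prop :=
  foldr (fun w rest => ptime vars w /\ rest) True ws.

Lemma ptime_catr T (us vars : seq (T -> bits)) F :
  ptime vars F -> ptime (us ++ vars) F.
Proof. by move=> pF; elim: us => //= u us; apply: ptime_weak1. Qed.

Lemma all_ptime_catr T (us vars ws : seq (T -> bits)) :
  all_ptime vars ws -> all_ptime (us ++ vars) ws.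
Proof. by elim: ws => //= w ws IH [pw /IH]; split=> //; apply: ptime_catr. Qed.

Lemma all_ptime_id T (vars : seq (T -> bits)) : all_ptime vars vars.
Proof.
elim: vars => //= v vars IH; split; first exact: (@ptime_var _ 0 (v :: vars)).
exact: (@all_ptime_catr _ [:: v]).
Qed.

Lemma ptime_cuts T (ws vars : seq (T -> bits)) F :
  all_ptime vars ws -> ptime (ws ++ vars) F -> ptime vars F.
Proof.
elim: ws => //= w ws IH [pw pws] pF; apply: IH => //.
by apply: ptime_cut pF; apply: ptime_catr.
Qed.

(** The arguments are computed into new registers by [ptime_cuts], after which the program for [F],
    reindexed along [h], reads these alone. *)
Lemma ptime_subst T U (h : T -> U) (vars : seq (T -> bits)) uvars F :
  all_ptime vars [seq v \o h | v <- uvars] -> ptime uvars F ->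
  ptime vars (F \o h).
Proof.
by move=> pv /(ptime_map (h := h)) pF; apply: ptime_cuts pv _; apply: ptime_catl.
Qed.

Section Apply.
Variables (T : Type) (vars : seq (T -> bits)).

Lemma ptime_app1 f : ptime [:: id] f ->
  forall F, ptime vars F -> ptime vars (fun t => f (F t)).
Proof. by move=> pf F pF; apply: (ptime_subst (h := F) _ pf). Qed.

Lemma ptime_app2 (f : bits -> bits -> bits) :
  ptime [:: fst; snd] (fun p => f p.1 p.2) ->
  forall F G, ptime vars F -> ptime vars G -> ptime vars (fun t => f (F t) (G t)).
Proof.
by move=> pf F G pF pG; apply: (ptime_subst (h := fun t => (F t, G t)) _ pf).
Qed.

Lemma ptime_app4 (f : bits -> bits -> bits -> bits -> bits) :
  ptime [:: (fun p => p.1.1.1); (fun p => p.1.1.2); (fun p => p.1.2); (fun p => p.2)]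
    (fun p => f p.1.1.1 p.1.1.2 p.1.2 p.2) ->
  forall F G H K, ptime vars F -> ptime vars G -> ptime vars H -> ptime vars K ->
  ptime vars (fun t => f (F t) (G t) (H t) (K t)).
Proof.
move=> pf F G H K pF pG pH pK.
by apply: (ptime_subst (h := fun t => (F t, G t, H t, K t)) _ pf).
Qed.

Implicit Types (F G : T -> bits) (a b : T -> bool).

Lemma ptime_if b F G : ptimeb vars b -> ptime vars F -> ptime vars G ->
  ptime vars (fun t => if b t then F t else G t).
Proof.
move=> pb pF pG; have := ptime_branch (pred1 (Some true)) pb pF pG.
by apply: ptime_ext => t /=; case: (b t).
Qed.

Lemma ptimeb_if a b c : ptimeb vars a -> ptimeb vars b -> ptimeb vars c ->
  ptimeb vars (fun t => if a t then b t else c t).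
Proof.
move=> pa pb pc; have := ptime_if pa pb pc.
by apply: ptime_ext => t /=; case: (a t).
Qed.

Lemma ptimeb_const x : ptimeb vars (fun=> x).
Proof. exact/ptime_cons/ptime_nil. Qed.

Lemma ptimeb_head F : ptime vars F -> ptimeb vars (fun t => head false (F t)).
Proof.
move=> pF; have := ptime_branch (pred1 (Some true)) pF
  (ptimeb_const true) (ptimeb_const false).
by apply: ptime_ext => t /=; case: (F t) => [|[]].
Qed.

Lemma ptimeb_nilp F : ptime vars F -> ptimeb vars (fun t => nilp (F t)).
Proof.
move=> pF; have := ptime_branch (pred1 None) pF
  (ptimeb_const true) (ptimeb_const false).
by apply: ptime_ext => t /=; case: (F t) => [|[]].
Qed.

Lemma ptimeb_neg a : ptimeb vars a -> ptimeb vars (fun t => ~~ a t).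
Proof. by move=> pa; apply: ptimeb_if pa (ptimeb_const _) (ptimeb_const _). Qed.

Lemma ptimeb_and a b : ptimeb vars a -> ptimeb vars b ->
  ptimeb vars (fun t => a t && b t).
Proof. by move=> pa pb; apply: ptimeb_if pa pb (ptimeb_const _). Qed.

Lemma ptimeb_or a b : ptimeb vars a -> ptimeb vars b ->
  ptimeb vars (fun t => a t || b t).
Proof. by move=> pa pb; apply: ptimeb_if pa (ptimeb_const _) pb. Qed.

Lemma ptimeb_eqb a b : ptimeb vars a -> ptimeb vars b ->
  ptimeb vars (fun t => a t == b t).
Proof.
move=> pa pb; have := ptimeb_if pa pb (ptimeb_neg pb).
by apply: ptime_ext => t /=; case: (a t) (b t) => -[].
Qed.

Lemma ptime_consb b F : ptimeb vars b -> ptime vars F ->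
  ptime vars (fun t => b t :: F t).
Proof.
move=> pb pF; have := ptime_if pb (ptime_cons true pF) (ptime_cons false pF).
by apply: ptime_ext => t; case: (b t).
Qed.

End Apply.

(** Growth by a bounded amount per round, whatever the state, keeps the iterates linear in the
    number of rounds; repeated doubling, which would leave polynomial size, is thereby excluded. *)
Lemma ptime_iter_growth T (vars : seq (T -> bits)) clock init
    (next : T -> bits * bits -> bits * bits) (grow : T -> nat) (b : bool) :
  let vars' := (fun p => p.2.1) :: (fun p => p.2.2) ::
               [seq (fun p => v p.1) | v <- vars] in
  ptime vars clock ->
  ptime vars (fun t => (init t).1) -> ptime vars (fun t => (init t).2) ->
  ptime vars' (fun p => (next p.1 p.2).1) ->
  ptime vars' (fun p => (next p.1 p.2).2) ->
  pbounded (total_size vars) grow ->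
  (forall t x, size (next t x).1 + size (next t x).2 <=
               size x.1 + size x.2 + grow t) ->
  ptime vars (fun t => let x := iter (size (clock t)) (next t) (init t) in
                       if b then x.1 else x.2).
Proof.
move=> vars' pc pi1 pi2 pn1 pn2 pg le_g.
have pzc := ptime_size pc; have pz1 := ptime_size pi1; have pz2 := ptime_size pi2.
apply: (@ptime_iter _ _ _ _ _ (fun t => size (init t).1 + size (init t).2
   + size (clock t) * grow t)) => //; first by solve_pbounded.
move=> t n x le_n; apply: (@leq_trans (size (init t).1 + size (init t).2 + n * grow t)).
  rewrite {}/x; elim: n {le_n} => [|n IH]; first by rewrite mul0n addn0.
  by rewrite iterS; apply: leq_trans (le_g _ _) _; rewrite mulSn; lia.
by rewrite leq_add2l leq_mul2r le_n orbT.
Qed.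

Ltac ptime_var_tac :=
  match goal with |- ptime ?vs _ => first
    [ exact (@ptime_var _ 0 vs isT) | exact (@ptime_var _ 1 vs isT)
    | exact (@ptime_var _ 2 vs isT) | exact (@ptime_var _ 3 vs isT)
    | exact (@ptime_var _ 4 vs isT) | exact (@ptime_var _ 5 vs isT) ]
  end.

(* The shape of the function selects the closure lemma, so that [solve_ptime] is a syntax-directed
   search; the costs make it try equality of bits before equality of words. *)
#[local] Hint Extern 0 (ptime _ _) => ptime_var_tac : ptime.
#[local] Hint Extern 1 (ptime _ (fun _ => [::])) => apply: ptime_nil : ptime.
#[local] Hint Extern 3 (ptime _ (fun t => true :: _)) =>
  apply: ptime_cons : ptime.
#[local] Hint Extern 3 (ptime _ (fun t => false :: _)) =>
  apply: ptime_cons : ptime.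
#[local] Hint Extern 4 (ptime _ (fun t => _ :: _)) =>
  apply: ptime_consb : ptime.
#[local] Hint Extern 1 (ptime _ (fun t => behead _)) =>
  apply: ptime_behead : ptime.
#[local] Hint Extern 1 (ptime _ (fun t => if _ then _ else _)) =>
  apply: ptime_if : ptime.
#[local] Hint Extern 1 (ptimeb _ (fun t => head false _)) =>
  apply: ptimeb_head : ptime.
#[local] Hint Extern 1 (ptimeb _ (head false)) => apply: ptimeb_head : ptime.
#[local] Hint Extern 1 (ptime _ behead) => apply: ptime_behead : ptime.
#[local] Hint Extern 1 (ptimeb _ (fun t => ~~ _)) => apply: ptimeb_neg : ptime.
#[local] Hint Extern 1 (ptimeb _ (fun t => _ && _)) =>
  apply: ptimeb_and : ptime.
#[local] Hint Extern 1 (ptimeb _ (fun t => _ || _)) => apply: ptimeb_or : ptime.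
#[local] Hint Extern 1 (ptimeb _ (fun t => if _ then _ else _)) =>
  apply: ptimeb_if : ptime.
#[local] Hint Extern 1 (ptimeb _ (fun t => nilp _)) =>
  apply: ptimeb_nilp : ptime.
#[local] Hint Extern 2 (ptimeb _ (fun t => eq_op _ _)) =>
  apply: ptimeb_eqb : ptime.

Ltac solve_ptime := cbv beta zeta; solve [auto 100 with ptime nocore].

(** * Elementary functions on words *)

Lemma iter_fst (f : bits -> bits) n x :
  iter n (fun y => (f y.1, [::])) (x, [::]) = (iter n f x, [::] : bits).
Proof. by elim: n => //= n ->. Qed.

Lemma iter_behead n (s : bits) : iter n behead s = drop n s.
Proof. by elim: n s => [|n IH] s; rewrite ?drop0 // iterSr IH; case: s. Qed.

Lemma ptime_drop T (vars : seq (T -> bits)) F G : ptime vars F -> ptime vars G ->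
  ptime vars (fun t => drop (size (F t)) (G t)).
Proof.
apply: (@ptime_app2 _ _ (fun u v => drop (size u) v)).
apply: (ptime_ext _ (@ptime_iter_growth (bits * bits) [:: fst; snd] fst
  (fun p => (p.2, [::])) (fun _ y => (behead y.1, [::])) (fun=> 0) true
  _ _ _ _ _ _ _)) => /=; try by solve_ptime.
- by case=> u v /=; rewrite iter_fst /= iter_behead.
- exact: pbounded_const.
- by move=> p x /=; rewrite size_behead; lia.
Qed.

Lemma iter_catrev (u v : bits) n :
  iter n (fun y => (behead y.1, if nilp y.1 then y.2 else head false y.1 :: y.2)) (u, v)
  = (drop n u, catrev (take n u) v).
Proof.
elim: n u v => [|n IH] u v; first by rewrite drop0 take0.
by rewrite iterSr IH; case: u => //=.
Qed.

Lemma ptime_catrev T (vars : seq (T -> bits)) F G : ptime vars F -> ptime vars G ->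
  ptime vars (fun t => catrev (F t) (G t)).
Proof.
apply: (@ptime_app2 _ _ catrev).
apply: (ptime_ext _ (@ptime_iter_growth (bits * bits) [:: fst; snd] fst
  (fun p => (p.1, p.2))
  (fun _ y => (behead y.1, if nilp y.1 then y.2 else head false y.1 :: y.2))
  (fun=> 1) false _ _ _ _ _ _ _)) => /=; try by solve_ptime.
- by case=> u v /=; rewrite iter_catrev /= take_size.
- exact: pbounded_const.
- by move=> p [[|b x] y] /=; lia.
Qed.

Lemma ptime_cat T (vars : seq (T -> bits)) F G : ptime vars F -> ptime vars G ->
  ptime vars (fun t => F t ++ G t).
Proof.
move=> pF pG; have := ptime_catrev (ptime_catrev pF (@ptime_nil _ _)) pG.
by apply: ptime_ext => t; rewrite catrevE revK.
Qed.

Lemma ptime_unary T (vars : seq (T -> bits)) F : ptime vars F ->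
  ptime vars (fun t => nseq (size (F t)) true).
Proof.
move=> pF; apply: (@ptime_app1 _ _ (fun u => nseq (size u) true)) pF.
apply: (ptime_ext _ (@ptime_iter_growth bits [:: id] id (fun p => ([::], [::]))
  (fun _ y => (true :: y.1, [::])) (fun=> 1) true _ _ _ _ _ _ _)) => /=;
  try by solve_ptime.
- move=> u /=; rewrite iter_fst /=.
  by elim: (size u) => //= n ->.
- exact: pbounded_const.
- by move=> p x /=; lia.
Qed.

(** The state is frozen at the first mismatch or when a word runs out, so the words are equal
    exactly when both components end up empty. *)
Definition eq_next (y : bits * bits) : bits * bits :=
  if ~~ nilp y.1 && ~~ nilp y.2 && (head false y.1 == head false y.2)
  then (behead y.1, behead y.2) else y.

Lemma iter_eq_next (u v : bits) n : size u <= n ->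
  let y := iter n eq_next (u, v) in nilp y.1 && nilp y.2 = (u == v).
Proof.
elim: n u v => [|n IH] [|a u] [|b v] // le_n; rewrite iterSr.
- by rewrite iter_fix.
- by rewrite iter_fix.
- by rewrite iter_fix.
rewrite {2}/eq_next /= eqseq_cons; case: eqP => /= [_|ne]; first exact: IH.
by rewrite iter_fix // /eq_next /=; case: eqP.
Qed.

Lemma ptimeb_eq T (vars : seq (T -> bits)) F G : ptime vars F -> ptime vars G ->
  ptimeb vars (fun t => F t == G t).
Proof.
apply: (@ptime_app2 _ _ (fun u v => [:: u == v])).
have H b := @ptime_iter_growth (bits * bits) [:: fst; snd] fst id
  (fun _ => eq_next) (fun=> 0) b.
have {}H b : ptime [:: fst; snd] (fun t : bits * bits =>
     let x := iter (size t.1) eq_next t in if b then x.1 else x.2).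
  apply: H; try by solve_ptime.
  - apply: ptime_ext (_ : ptime _ (fun p => if ~~ nilp p.2.1 && ~~ nilp p.2.2 &&
      (head false p.2.1 == head false p.2.2) then behead p.2.1 else p.2.1)).
      by move=> p; rewrite /eq_next; case: ifP.
    by solve_ptime.
  - apply: ptime_ext (_ : ptime _ (fun p => if ~~ nilp p.2.1 && ~~ nilp p.2.2 &&
      (head false p.2.1 == head false p.2.2) then behead p.2.2 else p.2.2)).
      by move=> p; rewrite /eq_next; case: ifP.
    by solve_ptime.
  - exact: pbounded_const.
  - by move=> _ x; rewrite /eq_next; case: ifP => _ /=; rewrite ?size_behead; lia.
have := ptimeb_and (ptimeb_nilp (H true)) (ptimeb_nilp (H false)).
by apply: ptime_ext => -[u v] /=; rewrite iter_eq_next.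
Qed.

#[local] Hint Extern 1 (ptime _ (fun t => _ ++ _)) => apply: ptime_cat : ptime.
#[local] Hint Extern 1 (ptime _ (fun t => drop (size _) _)) =>
  apply: ptime_drop : ptime.
#[local] Hint Extern 1 (ptime _ (fun t => nseq (size _) true)) =>
  apply: ptime_unary : ptime.
#[local] Hint Extern 3 (ptimeb _ (fun t => eq_op _ _)) =>
  apply: ptimeb_eq : ptime.

(** * Loops over indices and over encoded sequences *)

Section Loops.
Variables (T : Type) (vars : seq (T -> bits)).

Lemma ptime_size_param (piece : T -> bits -> bits) (F : T -> bits) :
  ptime (snd :: [seq (fun p => v p.1) | v <- vars]) (fun p => piece p.1 p.2) ->
  ptime vars F ->
  exists2 g, pbounded (total_size vars) g
    & forall t r, size r <= size (F t) -> size (piece t r) <= g t.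
Proof.
move=> /ptime_size[k le_k] /ptime_size pF.
exists (fun t => (size (F t) + total_size vars t + 2) ^ k).
  apply: (@pbounded_trans _ _ (fun t => size (F t) + total_size vars t)).
    by solve_pbounded.
  by exists k.
move=> t r le_r; apply: leq_trans (le_k (t, r)) _.
rewrite /total_size /= -map_comp; case: k {le_k} => // k.
by rewrite leq_exp2r // /comp /=; lia.
Qed.

Lemma ptime_param (W : Type) (us : seq (W -> bits)) (h : W -> T)
    (piece : T -> bits -> bits) (R : W -> bits) :
  ptime (snd :: [seq (fun p => v p.1) | v <- vars]) (fun p => piece p.1 p.2) ->
  ptime us R ->
  ptime (us ++ [seq (fun w => v (h w)) | v <- vars]) (fun w => piece (h w) (R w)).
Proof.
move=> pp pR; apply: (ptime_subst (h := fun w => (h w, R w)) _ pp) => /=.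
split; first exact: ptime_catl.
by rewrite -map_comp; apply/all_ptime_catr/all_ptime_id.
Qed.

Lemma ptime_fst (us : seq (T * (bits * bits) -> bits)) F : ptime vars F ->
  ptime (us ++ [seq (fun p => v p.1) | v <- vars]) (fun p => F p.1).
Proof. by move=> /(ptime_map (h := fst)) pF; apply: ptime_catr. Qed.

(** [y.1] is what remains of the counter; the unary index handed to [piece] is the full length minus
    this remainder, so it counts upwards while [y.1] shrinks. *)
Definition for_next (piece : T -> bits -> bits) (u : T -> bits) t
    (y : bits * bits) : bits * bits :=
  (behead y.1, y.2 ++ piece t (drop (size y.1) (nseq (size (u t)) true))).

Lemma iter_for_next piece u t n : n <= size (u t) ->
  iter n (for_next piece u t) (u t, [::]) =
  (drop n (u t), flatten [seq piece t (nseq i true) | i <- iota 0 n]).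
Proof.
elim: n => [|n IH] lt_n; first by rewrite drop0.
have -> : iota 0 n.+1 = rcons (iota 0 n) n by rewrite -[n.+1]addn1 iotaD -cats1.
rewrite iterS IH 1?ltnW // /for_next /= drop_nseq size_drop subKn 1?ltnW //.
by rewrite map_rcons flatten_rcons -drop1 drop_drop add1n.
Qed.

Lemma ptime_for (piece : T -> bits -> bits) u :
  ptime vars u ->
  ptime (snd :: [seq (fun p => v p.1) | v <- vars]) (fun p => piece p.1 p.2) ->
  ptime vars
    (fun t => flatten [seq piece t (nseq i true) | i <- iota 0 (size (u t))]).
Proof.
move=> pu pp; have [g pg gP] := ptime_size_param pp pu.
apply: (ptime_ext _ (@ptime_iter_growth _ vars u (fun t => (u t, [::]))
  (for_next piece u) g false _ _ _ _ _ _ _)) => //=; try by solve_ptime.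
- by move=> t /=; rewrite iter_for_next.
- apply: ptime_cat; first by ptime_var_tac.
  have pd : ptime (([:: fun p => p.2.1; fun p => p.2.2] : seq (T * (bits * bits) -> bits))
     ++ [seq (fun p => v p.1) | v <- vars])
     (fun p => drop (size p.2.1) (nseq (size (u p.1)) true)).
    apply: ptime_drop; first by ptime_var_tac.
    exact/ptime_unary/ptime_fst.
  apply: ptime_cut pd _.
  exact: (@ptime_param _ [:: _; _; _] fst piece _ pp (@ptime_var _ 0 [:: _; _; _] isT)).
- move=> t x; rewrite size_behead size_cat.
  have := gP t (drop (size x.1) (nseq (size (u t)) true)).
  by rewrite size_drop size_nseq leq_subr => /(_ isT); lia.
Qed.

(** In [enc_seq] a [true] announces an item and [false] ends the sequence. Both functions receive
    the whole remaining input: [emit] reads the item at its head, [skip] goes past it. *)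
Definition scan_next (skip : bits -> bits) (emit : bits -> bits -> bits)
    (y : bits * bits) : bits * bits :=
  if head false y.1 then (skip (behead y.1), emit (behead y.1) y.2) else y.

(* [size r] iterations are enough for any sequence encoded at the head of [r];
   [scan_next] does nothing once the terminator has been reached. *)
Definition scan skip emit (r o : bits) : bits * bits :=
  iter (size r) (scan_next skip emit) (r, o).

(** The conditions on [skip] and [emit] also cover malformed words, on which the time bound must
    hold too: the remainder never lengthens, and a round adds at most [g t] to the output. *)
Lemma ptime_scan skip (emit : T -> bits -> bits -> bits) (R O : T -> bits)
    (g : T -> nat) (b : bool) :
  ptime [:: id] skip -> (forall r, size (skip r) <= size r) ->
  ptime ((fun p => p.2.1) :: (fun p => p.2.2) :: [seq (fun p => v p.1) | v <- vars])
    (fun p => emit p.1 p.2.1 p.2.2) ->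
  pbounded (total_size vars) g ->
  (forall t r o, size r <= size (R t) -> size (emit t r o) <= size o + g t) ->
  ptime vars R -> ptime vars O ->
  ptime vars (fun t => let x := scan skip (emit t) (R t) (O t) in
                       if b then x.1 else x.2).
Proof.
move=> ps le_s pe pg le_g pR pO.
have pzR := ptime_size pR; have pzO := ptime_size pO.
apply: (@ptime_iter _ vars R (fun t => (R t, O t)) (fun t => scan_next skip (emit t))
  (fun t => size (R t) + (size (O t) + size (R t) * g t))) => //.
- apply: (@ptime_ext _ _ (fun p => if head false p.2.1 then skip (behead p.2.1) else p.2.1)).
    by move=> p; rewrite /scan_next; case: ifP.
  apply: ptime_if; try by solve_ptime.
  by apply: (ptime_app1 ps); solve_ptime.
- apply: (@ptime_ext _ _ (fun p => if head false p.2.1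
      then emit p.1 (behead p.2.1) p.2.2 else p.2.2)).
    by move=> p; rewrite /scan_next; case: ifP.
  apply: ptime_if; try by solve_ptime.
  apply: (ptime_subst (h := fun p : T * (bits * bits) =>
    (p.1, (behead p.2.1, p.2.2))) _ pe) => /=.
  do 2!(split; first by rewrite /comp /=; solve_ptime).
  rewrite -map_comp.
  exact: (@all_ptime_catr _ [:: _; _] _ _ (@all_ptime_id _ _)).
- by solve_pbounded.
- move=> t n x le_n.
  suff [le1 le2] : size x.1 <= size (R t) /\ size x.2 <= size (O t) + n * g t.
    by rewrite leq_add // (leq_trans le2) // leq_add2l leq_mul2r le_n orbT.
  rewrite {}/x; elim: n {le_n} => [|n [IH1 IH2]] /=; first by rewrite mul0n addn0.
  move: IH1 IH2; move: (iter _ _ _) => x IH1 IH2; rewrite /scan_next mulSn.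
  case: ifP => _ /=; last by split=> //; lia.
  have lt1 : size (behead x.1) <= size (R t) by rewrite size_behead; lia.
  by split; [apply: leq_trans (le_s _) lt1|have := le_g t _ x.2 lt1; lia].
Qed.

Lemma ptime_scan_cat skip (piece : T -> bits -> bits) (R O : T -> bits) (b : bool) :
  ptime [:: id] skip -> (forall r, size (skip r) <= size r) ->
  ptime (snd :: [seq (fun p => v p.1) | v <- vars]) (fun p => piece p.1 p.2) ->
  ptime vars R -> ptime vars O ->
  ptime vars (fun t => let x := scan skip (fun r o => o ++ piece t r) (R t) (O t) in
                       if b then x.1 else x.2).
Proof.
move=> ps le_s pp pR pO; have [g pg gP] := ptime_size_param pp pR.
apply: (ptime_scan (g := g)) => //.
  apply: ptime_cat; first by ptime_var_tac.
  exact: (@ptime_param _ [:: _; _] fst piece _ pp (@ptime_var _ 0 [:: _; _] isT)).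
by move=> t r o le_r; rewrite size_cat leq_add2l gP.
Qed.

End Loops.

(** Every item contributes its flag bit, so the input is at least as long as the number of items;
    surplus rounds are idle on the terminator, which is left in place. *)
Lemma scan_enc (A : Type) (enc : A -> bits) skip emit (emit' : A -> bits -> bits) s r o :
  (forall x u, skip (enc x ++ u) = u) ->
  (forall x u v, emit (enc x ++ u) v = emit' x v) ->
  scan skip emit (enc_seq enc s ++ r) o =
  (false :: r, foldl (fun v x => emit' x v) o s).
Proof.
move=> skipE emitE; rewrite /scan.
have : size s <= size (enc_seq enc s ++ r).
  elim: s => //= x s IH; rewrite ltnS -catA size_cat.
  by apply: leq_trans IH _; rewrite leq_addl.
move: (size (enc_seq _ _ ++ r)) => n; elim: s n o => [|x s IH] n o le_n.
  by rewrite iter_fix.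
case: n le_n => // n le_n; rewrite iterSr {2}/scan_next /= -catA skipE emitE.
exact: IH.
Qed.

(** * From register programs to machines *)

Lemma instr_reg_bounded c : exists k, all (fun a => instr_reg a < k) c.
Proof.
elim: c => [|a c [k IH]]; first by exists 0.
exists (k + (instr_reg a).+1); rewrite /= ltn_addl //=.
by apply: sub_all IH => b; lia.
Qed.

Lemma ptime_polytime m (F : m.-tuple bits -> bits) :
  ptime [seq (fun xs : m.-tuple bits => nth [::] xs i) | i <- iota 0 m] F ->
  polytime F.
Proof.
set vars := map _ _ => pF; have pzF := ptime_size pF.
have sz : size (iota 0 m) = size vars by rewrite size_map.
have lt : all (fun i => i < m) (iota 0 m).
  by apply/allP => i; rewrite mem_iota.
have [c [time [pt rc]]] := pF _ m sz lt.
(* The result is found in register [m] and moved to the output tape [m + k] with scratch register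
   [m + 1]; adding 2 keeps the three distinct. *)
have [k' lt_k'] := instr_reg_bounded c; pose k := k'.+2.
have [e le_e] : pbounded (total_size vars)
    (fun xs => time xs + (12 * size (F xs) + 5 * 0 + 3)).
  by solve_pbounded.
have varsE (xs : m.-tuple bits) : [seq v xs | v <- vars] = xs.
  by rewrite -map_comp map_nth_iota0 ?size_tuple // take_oversize ?size_tuple.
apply: (@polytime_runs m k F (c ++ movec m (m + k) (m + 1)) _ (('X + 2%:P) ^+ e)%R).
- rewrite all_cat; apply/andP; split; last first.
    have : 1 < k by [].
    by rewrite /movec /clearc /pour /whilec /ifc /=; move: (k) => l lt_l; lia.
  by apply: sub_all lt_k' => a; rewrite /k; lia.
- move=> xs; apply: leq_trans (le_e xs) _.
  rewrite horner_exp hornerD hornerX hornerC.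
  by rewrite -[sumn _]/(sumn [seq size x | x <- xs]) -{1}varsE -map_comp.
- move=> xs; exists (upd (upd (upd (nth [::] xs) m (F xs)) m [::]) (m + k) (F xs)).
    by rewrite updE eqxx.
  have xs0 j : m <= j -> nth [::] xs j = [::].
    by move=> le_j; rewrite nth_default ?size_tuple.
  apply: (runs_cat (rc xs _ _ xs0)).
    by rewrite varsE map_nth_iota0 ?size_tuple // take_oversize ?size_tuple.
  have := @runs_move m (m + k) (m + 1) (upd (nth [::] xs) m (F xs)).
  rewrite !updE !eqn_offset /= eqxx !xs0 ?leq_addr //; exact.
Qed.

(** * Parsing and evaluating encoded circuits *)

Lemma foldl_concat (A : Type) (f : A -> bits) s o :
  foldl (fun v x => v ++ f x) o s = o ++ flatten [seq f x | x <- s].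
Proof. by elim: s o => [|x s IH] o /=; rewrite ?cats0 // IH catA. Qed.

Lemma size_scan skip emit r o :
  (forall r, size (skip r) <= size r) -> size (scan skip emit r o).1 <= size r.
Proof.
move=> le_s; rewrite /scan; set n := {1}(size r); elim: n => [|n IH] //.
rewrite iterS /scan_next; case: ifP => //= _.
by apply: leq_trans (le_s _) _; rewrite size_behead (leq_trans (leq_pred _)).
Qed.

Definition skip_seq (skip : bits -> bits) (r : bits) : bits :=
  behead (scan skip (fun _ o => o ++ [::]) r [::]).1.

Lemma skip_seq_enc (A : Type) (enc : A -> bits) skip s r :
  (forall x u, skip (enc x ++ u) = u) -> skip_seq skip (enc_seq enc s ++ r) = r.
Proof.
by move=> skipE; rewrite /skip_seq (scan_enc (emit' := fun _ o => o ++ [::]) _ _ _ skipE).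
Qed.

Lemma ptime_skip_seq skip : ptime [:: id] skip ->
  (forall r, size (skip r) <= size r) ->
  forall T (vars : seq (T -> bits)) F, ptime vars F ->
  ptime vars (fun t => skip_seq skip (F t)).
Proof.
move=> ps le_s T vars F pF; apply: ptime_behead.
by apply: (@ptime_scan_cat _ _ _ (fun _ _ => [::]) F (fun=> [::]) true) => //; solve_ptime.
Qed.

(** [enc_nat n] is read as an [enc_seq] of [n] items with empty encodings; hence skipping an item is
    the identity. *)
Definition nat_scan (r : bits) := scan id (fun _ o => o ++ [:: true]) r [::].
Definition skip_nat (r : bits) : bits := behead (nat_scan r).1.
Definition read_nat (r : bits) : bits := (nat_scan r).2.

Lemma nat_scan_enc n r : nat_scan (enc_nat n ++ r) = (false :: r, nseq n true).
Proof.
have -> : enc_nat n = enc_seq (fun _ : unit => [::]) (nseq n tt).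
  by rewrite /enc_nat; elim: n => //= n ->.
rewrite /nat_scan (scan_enc (emit' := fun _ o => o ++ [:: true])) //.
by rewrite (foldl_concat (fun=> [:: true])); congr (_, _); elim: n => //= n ->.
Qed.

Lemma skip_nat_enc n r : skip_nat (enc_nat n ++ r) = r.
Proof. by rewrite /skip_nat nat_scan_enc. Qed.

Lemma read_nat_enc n r : read_nat (enc_nat n ++ r) = nseq n true.
Proof. by rewrite /read_nat nat_scan_enc. Qed.

Lemma size_skip_nat r : size (skip_nat r) <= size r.
Proof. by rewrite size_behead; apply: leq_trans (leq_pred _) (size_scan _ _ _ _). Qed.

Lemma ptime_nat_scan T (vars : seq (T -> bits)) F b : ptime vars F ->
  ptime vars (fun t => let x := nat_scan (F t) in if b then x.1 else x.2).
Proof.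
move=> pF; apply: (@ptime_scan_cat _ _ _ (fun _ _ => [:: true]) F (fun=> [::]) b) => //;
solve_ptime.
Qed.

Lemma ptime_skip_nat T (vars : seq (T -> bits)) F : ptime vars F ->
  ptime vars (fun t => skip_nat (F t)).
Proof. by move=> pF; apply: ptime_behead (ptime_nat_scan true pF). Qed.

Lemma ptime_read_nat T (vars : seq (T -> bits)) F : ptime vars F ->
  ptime vars (fun t => read_nat (F t)).
Proof. exact: (ptime_nat_scan false). Qed.

#[local] Hint Extern 1 (ptime _ (fun t => skip_nat _)) =>
  apply: ptime_skip_nat : ptime.
#[local] Hint Extern 1 (ptime _ skip_nat) => apply: ptime_skip_nat : ptime.
#[local] Hint Extern 1 (ptime _ (fun t => read_nat _)) =>
  apply: ptime_read_nat : ptime.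

Definition skip_gate (r : bits) : bits :=
  let s := behead (behead r) in
  if head false r then skip_nat (skip_nat s)
  else if head false (behead r) then skip_nat s else behead s.

Lemma skip_gate_enc g r : skip_gate (enc_gate g ++ r) = r.
Proof. by case: g => [b|i|i j|i j]; rewrite /skip_gate /= -?catA ?skip_nat_enc. Qed.

Lemma size_skip_gate r : size (skip_gate r) <= size r.
Proof.
apply: (@leq_trans (size (behead (behead r)))); last by rewrite !size_behead; lia.
have := size_skip_nat; rewrite /skip_gate => le_s; case: ifP => _.
  exact: leq_trans (le_s _) (le_s _).
by case: ifP => _ //; rewrite size_behead leq_pred.
Qed.

Lemma ptime_skip_gate : ptime [:: id] skip_gate.
Proof. rewrite /skip_gate; solve_ptime. Qed.

Definition skip_bits : bits -> bits := skip_seq behead.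

Lemma size_behead_le (r : bits) : size (behead r) <= size r.
Proof. by rewrite size_behead leq_pred. Qed.

Lemma skip_bits_enc s r : skip_bits (enc_bits s ++ r) = r.
Proof. exact: skip_seq_enc. Qed.

Lemma ptime_skip_bits T (vars : seq (T -> bits)) F : ptime vars F ->
  ptime vars (fun t => skip_bits (F t)).
Proof. by apply: (ptime_skip_seq _ size_behead_le); solve_ptime. Qed.

Lemma ptime_skip_gates T (vars : seq (T -> bits)) F : ptime vars F ->
  ptime vars (fun t => skip_seq skip_gate (F t)).
Proof. exact: (ptime_skip_seq ptime_skip_gate size_skip_gate). Qed.

Lemma ptime_skip_nats T (vars : seq (T -> bits)) F : ptime vars F ->
  ptime vars (fun t => skip_seq skip_nat (F t)).
Proof. by apply: (ptime_skip_seq _ size_skip_nat); solve_ptime. Qed.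

Definition read_bits (r : bits) : bits :=
  (scan behead (fun u o => o ++ [:: head false u]) r [::]).2.

Lemma read_bits_enc s r : read_bits (enc_bits s ++ r) = s.
Proof.
rewrite /read_bits (scan_enc (emit' := fun b o => o ++ [:: b])) //= foldl_concat /=.
by elim: s => //= b s ->.
Qed.

Lemma ptime_read_bits T (vars : seq (T -> bits)) F : ptime vars F ->
  ptime vars (fun t => read_bits (F t)).
Proof.
move=> pF; apply: (@ptime_scan_cat _ _ _ (fun _ r => [:: head false r]) F (fun=> [::])
  false _ size_behead_le); solve_ptime.
Qed.

#[local] Hint Extern 1 (ptime _ (fun t => skip_bits _)) =>
  apply: ptime_skip_bits : ptime.
#[local] Hint Extern 1 (ptime _ (fun t => skip_seq skip_gate _)) =>
  apply: ptime_skip_gates : ptime.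
#[local] Hint Extern 1 (ptime _ (fun t => skip_seq skip_nat _)) =>
  apply: ptime_skip_nats : ptime.
#[local] Hint Extern 1 (ptime _ (fun t => read_bits _)) =>
  apply: ptime_read_bits : ptime.

Definition bit_at (w u : bits) : bool := head false (drop (size u) w).

Lemma bit_atE w u : bit_at w u = nth false w (size u).
Proof. by rewrite /bit_at -nth0 nth_drop addn0. Qed.

Lemma ptimeb_bit_at T (vars : seq (T -> bits)) F G : ptime vars F -> ptime vars G ->
  ptimeb vars (fun t => bit_at (F t) (G t)).
Proof. by move=> pF pG; rewrite /bit_at; solve_ptime. Qed.

#[local] Hint Extern 1 (ptimeb _ (fun t => bit_at _ _)) =>
  apply: ptimeb_bit_at : ptime.

Definition eval_gate (r w : bits) : bool :=
  let s := behead (behead r) in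
  let x := bit_at w (read_nat s) in
  let y := bit_at w (read_nat (skip_nat s)) in
  if head false r then if head false (behead r) then x || y else x && y
  else if head false (behead r) then ~~ x else head false s.

Lemma eval_gate_enc g r w : eval_gate (enc_gate g ++ r) w = gate_value w g.
Proof.
by case: g => [b|i|i j|i j]; rewrite /eval_gate /= -?catA ?skip_nat_enc
  ?read_nat_enc ?bit_atE ?size_nseq.
Qed.

(** The accumulator of the scan is the list of wire values so far, which starts with the inputs and
    gains one bit per gate. *)
Definition eval_gates (gp x : bits) : bits :=
  (scan skip_gate (fun r w => w ++ [:: eval_gate r w]) gp x).2.

Lemma eval_gates_enc gs r x :
  eval_gates (enc_seq enc_gate gs ++ r) x = wire_values gs x.
Proof.
rewrite /eval_gates (scan_enc (emit' := fun g w => rcons w (gate_value w g))) //.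
  exact: skip_gate_enc.
by move=> g u w; rewrite eval_gate_enc cats1.
Qed.

Lemma ptime_eval_gates T (vars : seq (T -> bits)) F G : ptime vars F -> ptime vars G ->
  ptime vars (fun t => eval_gates (F t) (G t)).
Proof.
move=> pF pG; apply: (@ptime_scan _ _ _ (fun _ r w => w ++ [:: eval_gate r w]) F G
  (fun=> 1) false ptime_skip_gate size_skip_gate) => //.
- by rewrite /eval_gate; solve_ptime.
- exact: pbounded_const.
- by move=> t r w _; rewrite size_cat.
Qed.

Definition eval_outputs (op w : bits) : bits :=
  (scan skip_nat (fun r o => o ++ [:: bit_at w (read_nat r)]) op [::]).2.

Lemma eval_outputs_enc os r w :
  eval_outputs (enc_seq enc_nat os ++ r) w = [seq nth false w i | i <- os].
Proof.
rewrite /eval_outputs (scan_enc (emit' := fun i o => o ++ [:: nth false w i])).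
- by rewrite /= foldl_concat; elim: os => //= i os ->.
- exact: skip_nat_enc.
- by move=> i u v; rewrite read_nat_enc bit_atE size_nseq.
Qed.

Lemma ptime_eval_outputs T (vars : seq (T -> bits)) F G : ptime vars F -> ptime vars G ->
  ptime vars (fun t => eval_outputs (F t) (G t)).
Proof.
apply: ptime_app2; apply: (@ptime_scan_cat _ _ _ (fun p r => [:: bit_at p.2 (read_nat r)])
  fst (fun=> [::]) false _ size_skip_nat); solve_ptime.
Qed.

#[local] Hint Extern 1 (ptime _ (fun t => eval_gates _ _)) =>
  apply: ptime_eval_gates : ptime.
#[local] Hint Extern 1 (ptime _ (fun t => eval_outputs _ _)) =>
  apply: ptime_eval_outputs : ptime.

Definition eval_circuit (gp op x : bits) : bits := eval_outputs op (eval_gates gp x).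

Lemma ptime_eval_circuit T (vars : seq (T -> bits)) F G H :
  ptime vars F -> ptime vars G -> ptime vars H ->
  ptime vars (fun t => eval_circuit (F t) (G t) (H t)).
Proof. by move=> pF pG pH; rewrite /eval_circuit; solve_ptime. Qed.

#[local] Hint Extern 1 (ptime _ (fun t => eval_circuit _ _ _)) =>
  apply: ptime_eval_circuit : ptime.

(** * Producing encoded gates *)

Definition shift_gate (n : nat) (g : gate) : gate :=
  match g with
  | Const b => Const b
  | Not i => Not (n + i)
  | And i j => And (n + i) (n + j)
  | Or i j => Or (n + i) (n + j)
  end.

(** Wire numbers are unary, so prefixing the word [u] of bits [true] adds its length. *)
Definition shift_gate_bits (u r : bits) : bits :=
  let s := behead (behead r) in
  let x := u ++ read_nat s ++ [:: false] in
  let y := u ++ read_nat (skip_nat s) ++ [:: false] in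
  if head false r then true :: head false (behead r) :: x ++ y
  else if head false (behead r) then [:: false, true & x]
  else [:: false; false; head false s].

Lemma shift_gate_bits_enc n g r :
  shift_gate_bits (nseq n true) (enc_gate g ++ r) = enc_gate (shift_gate n g).
Proof.
by case: g => [b|i|i j|i j]; rewrite /shift_gate_bits /= -?catA ?skip_nat_enc
  ?read_nat_enc /enc_nat ?nseqD -?cats1 -?catA.
Qed.

Definition shift_gates_bits (gp u : bits) : bits :=
  (scan skip_gate (fun r o => o ++ true :: shift_gate_bits u r) gp [::]).2.

(** An [enc_seq] without its terminator: such pieces can be concatenated, so that a gate list is
    assembled from separately produced blocks. *)
Definition items (A : Type) (enc : A -> bits) (s : seq A) : bits :=
  flatten [seq true :: enc x | x <- s].

Lemma enc_seq_items (A : Type) (enc : A -> bits) s :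
  enc_seq enc s = items enc s ++ [:: false].
Proof. by elim: s => //= x s ->; rewrite /items /= -catA. Qed.

Lemma items_cat (A : Type) (enc : A -> bits) s s' :
  items enc (s ++ s') = items enc s ++ items enc s'.
Proof. by rewrite /items map_cat flatten_cat. Qed.

Lemma shift_gates_bits_enc n gs r :
  shift_gates_bits (enc_seq enc_gate gs ++ r) (nseq n true) =
  items enc_gate [seq shift_gate n g | g <- gs].
Proof.
rewrite /shift_gates_bits.
rewrite (scan_enc (emit' := fun g o => o ++ true :: enc_gate (shift_gate n g))).
- by rewrite /= foldl_concat /items -map_comp.
- exact: skip_gate_enc.
- by move=> g u v; rewrite shift_gate_bits_enc.
Qed.

Lemma ptime_shift_gates_bits T (vars : seq (T -> bits)) F G :
  ptime vars F -> ptime vars G ->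
  ptime vars (fun t => shift_gates_bits (F t) (G t)).
Proof.
apply: ptime_app2; apply: (@ptime_scan_cat _ _ _ (fun p r => true :: shift_gate_bits p.2 r)
  fst (fun=> [::]) false ptime_skip_gate size_skip_gate);
  rewrite /shift_gate_bits /=; solve_ptime.
Qed.

Definition shift_nats_bits (op u : bits) : bits :=
  (scan skip_nat (fun r o => o ++ true :: u ++ read_nat r ++ [:: false]) op [::]).2.

Lemma shift_nats_bits_enc n os r :
  shift_nats_bits (enc_seq enc_nat os ++ r) (nseq n true) =
  items enc_nat [seq n + i | i <- os].
Proof.
rewrite /shift_nats_bits (scan_enc (emit' := fun i o => o ++ true :: enc_nat (n + i))).
- by rewrite /= foldl_concat /items -map_comp.
- exact: skip_nat_enc.
- by move=> i u v; rewrite read_nat_enc /enc_nat nseqD -cats1 -catA.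
Qed.

Lemma ptime_shift_nats_bits T (vars : seq (T -> bits)) F G :
  ptime vars F -> ptime vars G ->
  ptime vars (fun t => shift_nats_bits (F t) (G t)).
Proof.
apply: ptime_app2; apply: (@ptime_scan_cat _ _ _
  (fun p r => true :: p.2 ++ read_nat r ++ [:: false])
  fst (fun=> [::]) false _ size_skip_nat); solve_ptime.
Qed.

#[local] Hint Extern 1 (ptime _ (fun t => shift_gates_bits _ _)) =>
  apply: ptime_shift_gates_bits : ptime.
#[local] Hint Extern 1 (ptime _ (fun t => shift_nats_bits _ _)) =>
  apply: ptime_shift_nats_bits : ptime.

(** * The reduction and the recovery of a solution *)

Lemma map_nth_iota_size (A : Type) (f : bool -> A) (s : bits) :
  [seq f (nth false s i) | i <- iota 0 (size s)] = [seq f b | b <- s].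
Proof. by rewrite -[in RHS](mkseq_nth false s) -map_comp. Qed.

Lemma flatten_items (A : Type) (enc : A -> bits) (f : nat -> A) (h : bits -> bits) n :
  (forall i, h (nseq i true) = true :: enc (f i)) ->
  flatten [seq h (nseq i true) | i <- iota 0 n] = items enc [seq f i | i <- iota 0 n].
Proof.
by move=> hE; rewrite /items -map_comp; congr flatten; apply: eq_map => i; rewrite hE.
Qed.

Lemma ptime_enc_bits T (vars : seq (T -> bits)) F : ptime vars F ->
  ptime vars (fun t => enc_bits (F t)).
Proof.
apply: ptime_app1; apply: (@ptime_ext _ _ (fun u =>
  flatten [seq [:: true; bit_at u (nseq i true)] | i <- iota 0 (size u)] ++ [:: false])).
  move=> u; rewrite /enc_bits enc_seq_items.
  rewrite (@flatten_items _ (fun b => [:: b]) (nth false u)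
    (fun k => [:: true; bit_at u k])).
    by rewrite (@map_nth_iota_size _ id) map_id.
  by move=> i; rewrite bit_atE size_nseq.
apply: ptime_cat; last by solve_ptime.
apply: (@ptime_for _ _ (fun u k => [:: true; bit_at u k])); solve_ptime.
Qed.

Lemma ptime_zeros T (vars : seq (T -> bits)) F : ptime vars F ->
  ptime vars (fun t => nseq (size (F t)) false).
Proof.
apply: (@ptime_app1 _ _ (fun u => nseq (size u) false)).
apply: (@ptime_ext _ _ (fun u : bits =>
  flatten [seq [:: false] | i <- iota 0 (size u)])).
  by move=> u; rewrite -[in RHS](size_iota 0 (size u)); elim: (iota _ _) => //= _ s ->.
apply: (@ptime_for _ _ (fun _ _ => [:: false])); solve_ptime.
Qed.

Lemma ptime_const_items T (vars : seq (T -> bits)) F : ptime vars F ->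
  ptime vars (fun t => items enc_gate (map Const (F t))).
Proof.
apply: (@ptime_app1 _ _ (fun u => items enc_gate (map Const u))).
apply: (@ptime_ext _ _ (fun u => flatten
  [seq [:: true; false; false; bit_at u (nseq i true)] | i <- iota 0 (size u)])).
  move=> u; rewrite -map_nth_iota_size.
  rewrite (@flatten_items _ enc_gate (fun i => Const (nth false u i))
    (fun k => [:: true; false; false; bit_at u k])) //.
  by move=> i; rewrite bit_atE size_nseq.
apply: (@ptime_for _ _ (fun u k => [:: true; false; false; bit_at u k])); solve_ptime.
Qed.

(** [And i i] copies wire [i]. A circuit reads its inputs from consecutive wires, so the input must
    be repeated in front of the second copy of [C]. *)
Definition copy_gates (n : nat) : seq gate := [seq And i i | i <- iota 0 n].

Lemma ptime_copy_gates T (vars : seq (T -> bits)) F : ptime vars F ->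
  ptime vars (fun t => items enc_gate (copy_gates (size (F t)))).
Proof.
apply: (@ptime_app1 _ _ (fun u => items enc_gate (copy_gates (size u)))).
pose piece k := [:: true, true, false & (k ++ [:: false]) ++ k ++ [:: false]].
apply: (@ptime_ext _ _ (fun u : bits => flatten
  [seq piece (nseq i true) | i <- iota 0 (size u)])).
  move=> u; apply: (@flatten_items _ enc_gate (fun i => And i i)) => i.
  by rewrite /piece /= /enc_nat -!cats1.
apply: (@ptime_for _ _ (fun _ k => piece k)); rewrite /piece; solve_ptime.
Qed.

(** A multiplexer controlled by wire [o] between fixed bits [b] and [c]: equal bits give a constant,
    and distinct ones make the output the wire itself or its negation. *)
Definition select_gate (o : nat) (v b c : bool) : gate :=
  if b == c then Const b else if v == c then And o o else Not o.

Lemma select_gateP w o v b c :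
  gate_value w (select_gate o v b c) = if nth false w o == v then c else b.
Proof. by rewrite /select_gate; case: b c v => [] [] [] //=; case: nth. Qed.

Definition select_gates (o : nat) (v : bool) (b c : bits) : seq gate :=
  [seq select_gate o v (nth false b i) (nth false c i) | i <- iota 0 (size b)].

Lemma ptime_select_gates T (vars : seq (T -> bits)) F G H K :
  ptime vars F -> ptime vars G -> ptime vars H -> ptime vars K ->
  ptime vars (fun t => items enc_gate
    (select_gates (size (F t)) (head false (G t)) (H t) (K t))).
Proof.
apply: (@ptime_app4 _ _ (fun o v b c => items enc_gate
  (select_gates (size o) (head false v) b c))).
pose piece (p : bits * bits * bits * bits) k :=
  let o := nseq (size p.1.1.1) true ++ [:: false] in
  true :: if bit_at p.1.2 k == bit_at p.2 k then [:: false; false; bit_at p.1.2 k]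
  else if head false p.1.1.2 == bit_at p.2 k then [:: true, false & o ++ o]
  else [:: false, true & o].
apply: (@ptime_ext _ _ (fun p => flatten
  [seq piece p (nseq i true) | i <- iota 0 (size p.1.2)])).
  move=> p; apply: flatten_items => i.
  rewrite /piece !bit_atE size_nseq /select_gate /enc_nat.
  by do 2!(case: ifP => _; rewrite ?cats1 //=).
apply: ptime_for; rewrite /piece; solve_ptime.
Qed.

#[local] Hint Extern 1 (ptime _ (fun t => enc_bits _)) =>
  apply: ptime_enc_bits : ptime.
#[local] Hint Extern 1 (ptime _ (fun t => nseq (size _) false)) =>
  apply: ptime_zeros : ptime.
#[local] Hint Extern 1 (ptime _ (fun t => items enc_gate (map Const _))) =>
  apply: ptime_const_items : ptime.
#[local] Hint Extern 1 (ptime _ (fun t => items enc_gate (copy_gates _))) =>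
  apply: ptime_copy_gates : ptime.
#[local] Hint Extern 1 (ptime _ (fun t => items enc_gate (select_gates _ _ _ _))) =>
  apply: ptime_select_gates : ptime.

(** [j] is a unary position that stops advancing at the first difference. *)
Definition diff_next (u v j : bits) : bits :=
  if bit_at u j == bit_at v j then true :: j else j.

Definition first_diff (u v : bits) : bits := iter (size u) (diff_next u v) [::].

Lemma first_diffP u v (j := size (first_diff u v)) :
  size u = size v -> u <> v -> j < size u /\ nth false u j <> nth false v j.
Proof.
move=> sz ne.
have H n : n <= size u -> let k := size (iter n (diff_next u v) [::]) in
    (forall i, i < n -> nth false u i = nth false v i) /\ k = n \/
    k < size u /\ nth false u k <> nth false v k.
  elim: n => [|n IH] lt_n; first by left.
  rewrite iterS; move: (IH (ltnW lt_n)); move: (iter _ _ _) => l /= IH'.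
  rewrite /diff_next !bit_atE; case: eqP => [e|ne_l]; last first.
    by case: IH' => [[le_l e_l]|[lt_l ?]]; right; split=> //; lia.
  case: IH' => [[le_l e_l]|[lt_l ?]] //; left; split; last by rewrite /= e_l.
  by move=> i; rewrite ltnS leq_eqVlt => /orP[/eqP->|/le_l//]; rewrite -e_l.
have [[e _]|//] := H _ (leqnn _).
by case: ne; exact: (@eq_from_nth _ false).
Qed.

Lemma ptime_first_diff T (vars : seq (T -> bits)) F G : ptime vars F -> ptime vars G ->
  ptime vars (fun t => first_diff (F t) (G t)).
Proof.
apply: ptime_app2; apply: (ptime_ext _ (@ptime_iter_growth (bits * bits) [:: fst; snd] fst
  (fun=> ([::], [::])) (fun p y => (diff_next p.1 p.2 y.1, [::])) (fun=> 1) true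
  _ _ _ _ _ _ _)) => /=; try by rewrite /diff_next; solve_ptime.
- by case=> u v /=; rewrite iter_fst.
- exact: pbounded_const.
- by move=> p x; rewrite /diff_next; case: ifP => _ /=; lia.
Qed.

Definition output_wire (op j : bits) : bits :=
  read_nat (behead (iter (size j) (fun r => skip_nat (behead r)) op)).

Lemma output_wireE os r j : size j < size os ->
  output_wire (enc_seq enc_nat os ++ r) j = nseq (nth 0 os (size j)) true.
Proof.
rewrite /output_wire; move: (size j) => {}j; elim: j os => [|j IH] [|i os] // lt_j.
  by rewrite /= -catA read_nat_enc.
by rewrite iterSr /= -catA skip_nat_enc IH.
Qed.

Lemma ptime_output_wire T (vars : seq (T -> bits)) F G : ptime vars F -> ptime vars G ->
  ptime vars (fun t => output_wire (F t) (G t)).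
Proof.
apply: ptime_app2; apply/ptime_read_nat/ptime_behead.
apply: (ptime_ext _ (@ptime_iter_growth (bits * bits) [:: fst; snd] snd
  (fun p => (p.1, [::])) (fun _ y => (skip_nat (behead y.1), [::])) (fun=> 0) true
  _ _ _ _ _ _ _)) => /=; try by solve_ptime.
- by case=> u v /=; rewrite (iter_fst (fun r => skip_nat (behead r))).
- exact: pbounded_const.
- by move=> p x; have := size_skip_nat (behead x.1); rewrite size_behead; lia.
Qed.

#[local] Hint Extern 1 (ptime _ (fun t => first_diff _ _)) =>
  apply: ptime_first_diff : ptime.
#[local] Hint Extern 1 (ptime _ (fun t => output_wire _ _)) =>
  apply: ptime_output_wire : ptime.

(** The encoding of [pigeon_of] is emitted in blocks. Shifting by the empty word turns an encoded
    list into items unchanged, [base] counts in unary the wires of one evaluation of [C], and [head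
    false [:: _]] gives the bit the form that [ptime_select_gates] expects. *)
Definition reduction_of (gp op a b c : bits) : bits :=
  let x := eval_circuit gp op (a ++ b) in
  let j := first_diff x (eval_circuit gp op (a ++ c)) in
  let base := nseq (size (eval_gates gp (a ++ b))) true in
  (nseq (size a) true ++ [:: false]) ++
  (items enc_gate (map Const a) ++ shift_gates_bits gp [::] ++
   items enc_gate (copy_gates (size a)) ++
   items enc_gate (select_gates (size (output_wire op j))
                     (head false [:: bit_at x j]) b c) ++
   shift_gates_bits gp base) ++ [:: false] ++
  (shift_nats_bits op [::] ++ shift_nats_bits op base) ++ [:: false] ++
  enc_bits (nseq (size a) false).

(** On encodings [gates_at], [outputs_at] and [nodes_at] are suffixes of the input; as the encodings
    are self-delimiting, whatever follows the wanted item may stay. *)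
Definition gates_at (w : bits) : bits := skip_nat w.
Definition outputs_at (w : bits) : bits := skip_seq skip_gate (gates_at w).
Definition nodes_at (w : bits) : bits := skip_seq skip_nat (outputs_at w).
Definition node_a (w : bits) : bits := read_bits (nodes_at w).
Definition node_b (w : bits) : bits := read_bits (skip_bits (nodes_at w)).
Definition node_c (w : bits) : bits := read_bits (skip_bits (skip_bits (nodes_at w))).

Definition reduction (w : bits) : bits :=
  reduction_of (gates_at w) (outputs_at w) (node_a w) (node_b w) (node_c w).

Lemma ptime_instance T (vars : seq (T -> bits)) F : ptime vars F ->
  [/\ ptime vars (fun t => gates_at (F t)), ptime vars (fun t => outputs_at (F t)),
      ptime vars (fun t => node_a (F t)), ptime vars (fun t => node_b (F t))
    & ptime vars (fun t => node_c (F t))].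
Proof.
move=> pF; split; rewrite /node_a /node_b /node_c /nodes_at /outputs_at /gates_at; solve_ptime.
Qed.

Lemma ptime_reduction T (vars : seq (T -> bits)) F : ptime vars F ->
  ptime vars (fun t => reduction (F t)).
Proof.
move=> /ptime_instance[pg po pa pb pc]; rewrite /reduction /reduction_of; solve_ptime.
Qed.

(** * Exhaustive search among given nodes *)

Section Search.
Variables (gp op : bits).

Definition col (p q : bits) : bits := eval_circuit gp op (p ++ q).

Definition two_coloured (p q r : bits) : bool :=
  [&& ~~ (p == q), ~~ (p == r), ~~ (q == r), col p q == col p r
    & ~~ (col p r == col q r)].

Definition asymmetric (p q : bits) : bool := ~~ (col p q == col q p).

Definition search (l : seq (nat * nat * nat)) (nodes : seq bits) : bits :=
  foldr (fun i out =>
    let p := nth [::] nodes i.1.1 in let q := nth [::] nodes i.1.2 in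
    let r := nth [::] nodes i.2 in
    if two_coloured p q r then enc_seq enc_bits [:: p; q; r]
    else if asymmetric p q then enc_seq enc_bits [:: p; q] else out) [::] l.

Definition violation (nodes : seq bits) (s : bits) : Prop :=
  (exists p q r, [/\ p \in nodes, q \in nodes & r \in nodes] /\
     s = enc_seq enc_bits [:: p; q; r] /\ two_coloured p q r) \/
  (exists p q, [/\ p \in nodes, q \in nodes, s = enc_seq enc_bits [:: p; q]
     & asymmetric p q]).

Definition clean (nodes : seq bits) : Prop :=
  forall p q r, p \in nodes -> q \in nodes -> r \in nodes ->
    ~~ two_coloured p q r /\ ~~ asymmetric p q.

Definition triples (n : nat) : seq (nat * nat * nat) :=
  [seq (i, k) | i <- [seq (i, j) | i <- iota 0 n, j <- iota 0 n], k <- iota 0 n].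

Lemma search_violation nodes :
  violation nodes (search (triples (size nodes)) nodes) \/ clean nodes.
Proof.
(* The induction needs the claim for every list of triples within range. *)
suff H l : {subset l <= triples (size nodes)} ->
    violation nodes (search l nodes) \/
    forall i, i \in l -> let p := nth [::] nodes i.1.1 in
      let q := nth [::] nodes i.1.2 in let r := nth [::] nodes i.2 in
      ~~ two_coloured p q r /\ ~~ asymmetric p q.
  have [|no_viol] := H _ (fun _ => id); [by left|right].
  move=> p q r /(nthP [::])[i lt_i <-] /(nthP [::])[j lt_j <-] /(nthP [::])[k lt_k <-].
  apply: (no_viol (i, j, k)); apply/allpairsP; exists (i, j, k); split=> //=.
    by apply/allpairsP; exists (i, j); rewrite !mem_iota.
  by rewrite mem_iota.
elim: l => [|[[i j] k] l IH] sub /=; first by right.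
have /allpairsP[[[i' j'] k'] /= [/allpairsP[[i'' j''] /= []]]] :=
  sub _ (mem_head _ _).
rewrite !mem_iota !add0n /= => lt_i lt_j [-> ->] lt_k [-> -> ->].
case: ifP => [v3|nv3].
  left; left; exists (nth [::] nodes i''), (nth [::] nodes j''), (nth [::] nodes k').
  by rewrite !mem_nth.
case: ifP => [v2|nv2].
  by left; right; exists (nth [::] nodes i''), (nth [::] nodes j''); rewrite !mem_nth.
have [|//|no_viol] := IH; [by move=> x xl; apply: sub; rewrite inE xl orbT|by left|right].
move=> x; rewrite inE => /orP[/eqP->|]; last exact: no_viol.
by rewrite /= nv3 nv2.
Qed.

Section Clean.
Variables (nodes : seq bits) (a w : bits).
Hypotheses (cl : clean nodes) (an : a \in nodes) (wn : w \in nodes) (aw : a != w).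

Lemma clean_sym p q : p \in nodes -> q \in nodes -> col p q = col q p.
Proof. by move=> pn qn; have [_ /negPn/eqP] := cl pn qn qn. Qed.

Lemma clean_triangle p q r : p \in nodes -> q \in nodes -> r \in nodes ->
  p != q -> p != r -> q != r -> col p q = col p r -> col p r = col q r.
Proof.
move=> pn qn rn pq pr qr /eqP e; have [+ _] := cl pn qn rn.
by rewrite /two_coloured pq pr qr e /= => /negPn/eqP.
Qed.

(** The triangle argument needs [x] distinct from [a] and [w]. For [x = a] the inequality and the
    assumed equality contradict each other outright; for [x = w] the inequality contradicts
    symmetry. *)
Lemma clean_no_value x : x \in nodes ->
  col a w <> col x a -> col x a <> col x w.
Proof.
move=> xn ne e.
have [xa|xa] := eqVneq x a; first by subst x; exact: ne (esym e).
have [xw|xw] := eqVneq x w; first by apply: ne; rewrite xw clean_sym.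
by apply: ne; rewrite e (clean_triangle xn an wn).
Qed.

Lemma clean_injective x y : x \in nodes -> y \in nodes -> col a w <> col x a ->
  col x a = col y a -> col x w = col y w -> x = y.
Proof.
(* A collision that involves [a] or [w]. For [u = w] the inequality contradicts symmetry; for
   [u = a] and [v] other than [w], the triangle [w a v] passes the colour of [a w] on to [a v],
   hence to the loop at [a]. *)
have ends u v : u \in nodes -> v \in nodes -> u = a \/ u = w -> u != v ->
    col a w <> col u a -> col u a = col v a -> col u w <> col v w.
  move=> un vn [|] eu; subst u => uv ne ea ew; last by apply: ne; rewrite clean_sym.
  have [vw|vw] := eqVneq v w.
    by subst v; apply: ne; rewrite ea clean_sym.
  have e : col w v = col a v.
    apply: clean_triangle; rewrite // 1?eq_sym // (clean_sym wn an) ew.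
    exact: clean_sym.
  by apply: ne; rewrite ea (clean_sym vn an) -e (clean_sym wn vn) -ew.
move=> xn yn ne ea ew; apply/eqP/negPn/negP => xy.
have [xa|xa] := eqVneq x a; first exact: (ends x y _ _ (or_introl xa)).
have [xw|xw] := eqVneq x w; first exact: (ends x y _ _ (or_intror xw)).
have yx : y != x by rewrite eq_sym.
have ne' : col a w <> col y a by rewrite -ea.
have [ya|ya] := eqVneq y a; first exact: (ends y x _ _ (or_introl ya)).
have [yw|yw] := eqVneq y w; first exact: (ends y x _ _ (or_intror yw)).
have e1 : col a y = col x y.
  apply: clean_triangle; rewrite // 1?eq_sym //.
  by rewrite (clean_sym an xn) ea clean_sym.
have e2 : col w y = col x y.
  apply: clean_triangle; rewrite // 1?eq_sym //.
  by rewrite (clean_sym wn xn) ew clean_sym.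
(* Both triangles carry the colour of [x y], so [y] sees [a] and [w] in the same colour. *)
by apply: (clean_no_value yn ne'); rewrite (clean_sym yn an) e1 -e2 clean_sym.
Qed.

End Clean.
End Search.

(** A solution of Pigeon encodes one word or two; a single one is repeated, so that there are always
    five nodes and [triples 5] is a fixed list. *)
Definition solver_nodes (w s : bits) : seq bits :=
  let rest := skip_bits (behead s) in
  let x := read_bits (behead s) in
  [:: node_a w; node_b w; node_c w; x;
      if head false rest then read_bits (behead rest) else x].

Definition solver (w s : bits) : bits :=
  search (gates_at w) (outputs_at w) (triples 5) (solver_nodes w s).

Lemma ptime_solver_node T (vars : seq (T -> bits)) F G i :
  ptime vars F -> ptime vars G ->
  ptime vars (fun t => nth [::] (solver_nodes (F t) (G t)) i).
Proof.
move=> /ptime_instance[_ _ pa pb pc] pG.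
case: i => [|[|[|[|[|i]]]]]; last first.
  by apply: (@ptime_ext _ _ (fun=> [::])) => [t|]; [rewrite nth_default|solve_ptime].
all: by cbv beta iota zeta delta [nth solver_nodes]; solve_ptime.
Qed.

(** The list of triples does not depend on the input, so the search unfolds to a fixed nest of
    conditionals; the induction is on that list. *)
Lemma ptime_solver T (vars : seq (T -> bits)) F G : ptime vars F -> ptime vars G ->
  ptime vars (fun t => solver (F t) (G t)).
Proof.
move=> pF pG; have [pg po _ _ _] := ptime_instance pF.
have pn i := ptime_solver_node i pF pG.
rewrite /solver; elim: (triples 5) => [|i l IH]; first exact: ptime_nil.
rewrite /= /two_coloured /asymmetric /col.
have p1 := pn i.1.1; have p2 := pn i.1.2; have p3 := pn i.2.
cbv beta zeta; solve_ptime.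
Qed.

(** * Correctness *)

Section Instance.
Variable I : ws_input.
Let n := ws_n I.
Let C := ws_C I.
Let w := enc_ws I.

Lemma gates_atE : exists r, gates_at w = enc_seq enc_gate (gates C) ++ r.
Proof. by eexists; rewrite /gates_at /w /enc_ws /enc_circuit -!catA skip_nat_enc. Qed.

Lemma outputs_atE : outputs_at w =
  enc_seq enc_nat (outputs C) ++
  enc_bits (ws_a I) ++ enc_bits (ws_b I) ++ enc_bits (ws_c I).
Proof.
rewrite /outputs_at /gates_at /w /enc_ws /enc_circuit -!catA skip_nat_enc.
by rewrite skip_seq_enc //; apply: skip_gate_enc.
Qed.

Lemma nodes_atE :
  nodes_at w = enc_bits (ws_a I) ++ enc_bits (ws_b I) ++ enc_bits (ws_c I).
Proof. by rewrite /nodes_at outputs_atE skip_seq_enc //; apply: skip_nat_enc. Qed.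

Lemma node_aE : node_a w = ws_a I.
Proof. by rewrite /node_a nodes_atE read_bits_enc. Qed.

Lemma node_bE : node_b w = ws_b I.
Proof. by rewrite /node_b nodes_atE skip_bits_enc read_bits_enc. Qed.

Lemma node_cE : node_c w = ws_c I.
Proof.
by rewrite /node_c nodes_atE !skip_bits_enc -[enc_bits _]cats0 read_bits_enc.
Qed.

Lemma eval_gates_atE x : eval_gates (gates_at w) x = wire_values (gates C) x.
Proof. by have [r ->] := gates_atE; rewrite eval_gates_enc. Qed.

Lemma eval_circuit_atE x :
  eval_circuit (gates_at w) (outputs_at w) x =
  [seq nth false (wire_values (gates C) x) i | i <- outputs C].
Proof. by rewrite /eval_circuit eval_gates_atE outputs_atE eval_outputs_enc. Qed.

Lemma colE (p q : node n) : col (gates_at w) (outputs_at w) p q = colour C p q.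
Proof. exact: eval_circuit_atE. Qed.

End Instance.

(** * Wire values of concatenated circuits *)

Lemma wire_values_cat gs gs' x :
  wire_values (gs ++ gs') x = wire_values gs' (wire_values gs x).
Proof. exact: foldl_cat. Qed.

Lemma size_wire_values gs x : size (wire_values gs x) = size x + size gs.
Proof.
elim: gs x => [|g gs IH] x; first by rewrite addn0.
by rewrite /= IH size_rcons addSnnS.
Qed.

Lemma wire_values_shift y gs x :
  wire_values [seq shift_gate (size y) g | g <- gs] (y ++ x) = y ++ wire_values gs x.
Proof.
elim: gs x => //= g gs IH x; rewrite -IH rcons_cat; congr (wire_values _ (_ ++ rcons _ _)).
have nthE i : nth false (y ++ x) (size y + i) = nth false x i.
  by rewrite nth_cat ltnNge leq_addr addKn.
by case: g => //= *; rewrite !nthE.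
Qed.

(** A block of gates that reads only wires before the block: [y] stands for the values of its
    earlier gates, and no gate depends on them. *)
Lemma wire_values_map (A : eqType) (f : A -> gate) (h : A -> bool) l x :
  (forall i y, i \in l -> gate_value (x ++ y) (f i) = h i) ->
  wire_values [seq f i | i <- l] x = x ++ [seq h i | i <- l].
Proof.
move=> fh; have -> : [seq h i | i <- l] = [::] ++ [seq h i | i <- l] by [].
rewrite -{1}(cats0 x); elim: l [::] fh => [|i l IH] y fh; first by rewrite !cats0.
rewrite /= fh ?mem_head // rcons_cat IH ?cat_rcons // => j z jl.
by apply: fh; rewrite inE jl orbT.
Qed.

Lemma nth_wire_values gs x i :
  i < size x -> nth false (wire_values gs x) i = nth false x i.
Proof.
elim: gs x => //= g gs IH x lt_i; rewrite IH ?size_rcons ?ltnS 1?ltnW //.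
by rewrite nth_rcons lt_i.
Qed.

Lemma gates_wf_cat m gs gs' :
  gates_wf m (gs ++ gs') = gates_wf m gs && gates_wf (m + size gs) gs'.
Proof.
elim: gs m => [|g gs IH] m /=; first by rewrite addn0.
by rewrite IH addSnnS andbA.
Qed.

Lemma gates_wf_all m gs : all (gate_wf m) gs -> gates_wf m gs.
Proof.
elim: gs m => //= g gs IH m /andP[-> wf]; apply: IH; apply: sub_all wf.
by case=> //= [i|i j|i j]; lia.
Qed.

Lemma gates_wf_shift b m gs :
  gates_wf m gs -> gates_wf (b + m) [seq shift_gate b g | g <- gs].
Proof.
elim: gs m => //= g gs IH m /andP[wf /IH]; rewrite addnS => ->; rewrite andbT.
by case: g wf => //= [i|i j|i j]; lia.
Qed.

(** * The Pigeon circuit *)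

Section PigeonCircuit.
Variables (n : nat) (C : circuit (2 * n + 2 * n) n) (a b c : node n).
Variables (o : nat) (v : bool).
Let base := 2 * n + 2 * n + size (gates C).

(** The first [base] wires are the input [x], the node [a] and the gates of [C], which thus find
    their inputs in place and need no shift. The second block repeats this layout from [base] on,
    with [x] and the selected node as inputs. *)
Definition pigeon_gates : seq gate :=
  map Const a ++ gates C ++ copy_gates (2 * n) ++ select_gates o v b c ++
  [seq shift_gate base g | g <- gates C].

Definition pigeon_outputs : seq nat := outputs C ++ [seq base + i | i <- outputs C].

Lemma pigeon_outputs_size : size pigeon_outputs == 2 * n.
Proof. by rewrite size_cat size_map !size_tuple addnn mul2n. Qed.

Lemma size_select_gates (b' c' : bits) : size (select_gates o v b' c') = size b'.
Proof. by rewrite size_map size_iota. Qed.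

Lemma size_pigeon_gates : 2 * n + size pigeon_gates = base + base.
Proof.
rewrite !size_cat !size_map size_iota size_iota !size_tuple /base; lia.
Qed.

Hypothesis o_lt : o < base.

Lemma pigeon_circuit_wf :
  gates_wf (2 * n) pigeon_gates &&
  all (fun i => i < 2 * n + size pigeon_gates) (Tuple pigeon_outputs_size).
Proof.
have /andP[wfC /allP wfO] := circuit_wf C.
rewrite size_pigeon_gates; apply/andP; split; last first.
  rewrite /= all_cat all_map; apply/andP; split.
    by apply/allP => i /wfO /=; rewrite -/base; lia.
  by apply/allP => i /wfO /=; rewrite -/base; lia.
rewrite !gates_wf_cat size_map size_tuple wfC -/base; apply/and5P; split=> //.
- by apply: gates_wf_all; rewrite all_map; apply/allP.
- apply: gates_wf_all; rewrite all_map; apply/allP => i.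
  by rewrite mem_iota /base /=; lia.
- apply: gates_wf_all; rewrite all_map; apply/allP => i _ /=.
  rewrite /select_gate; do 2!case: ifP => _ //=; rewrite ?andbb; lia.
- have := gates_wf_shift base wfC.
  by rewrite size_map size_iota size_select_gates size_tuple -addnA.
Qed.

Definition pigeon_of : pigeon_input :=
  MkPigeon (MkCircuit pigeon_circuit_wf) (nseq_tuple (2 * n) false).

Lemma enc_pigeon_of : enc_pigeon pigeon_of =
  (nseq (2 * n) true ++ [:: false]) ++ items enc_gate pigeon_gates ++ [:: false] ++
  items enc_nat pigeon_outputs ++ [:: false] ++ enc_bits (nseq (2 * n) false).
Proof.
rewrite /enc_pigeon /enc_circuit /= /enc_nat -cats1 !enc_seq_items -!catA.
by [].
Qed.

Lemma pigeon_ofE (x : node n) :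
  let wire := nth false (wire_values (gates C) (x ++ a)) o in
  val (ceval (pg_f pigeon_of) x) =
  colour C x a ++ colour C x (if wire == v then c else b).
Proof.
move=> wire; set w := if _ then _ else _.
rewrite /colour /ceval /= /pigeon_outputs map_cat -map_comp.
set W1 := wire_values (gates C) (x ++ a).
have sW1 : size W1 = base by rewrite /W1 size_wire_values size_cat !size_tuple.
(* Each block is one evaluation of [C]; the first one has length [base], the shift of the second. *)
have -> : wire_values pigeon_gates x = W1 ++ wire_values (gates C) (x ++ w).
  rewrite /pigeon_gates !wire_values_cat.
  rewrite (@wire_values_map _ Const id) // map_id -/W1.
  rewrite (@wire_values_map _ (fun i => And i i) (nth false x)); last first.
    move=> i y; rewrite mem_iota /= andbb => lt_i.
    rewrite nth_cat sW1 (_ : i < base); last by rewrite /base; lia.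
    rewrite nth_wire_values ?size_cat ?size_tuple; last by lia.
    by rewrite nth_cat size_tuple lt_i.
  have -> : [seq nth false x i | i <- iota 0 (2 * n)] = x.
    by have := mkseq_nth false x; rewrite size_tuple.
  rewrite (@wire_values_map _ _ (nth false w)); last first.
    move=> i y _; rewrite select_gateP -catA nth_cat sW1 o_lt.
    by rewrite /w /wire -/W1; case: eqP.
  have -> : [seq nth false w i | i <- iota 0 (size b)] = w.
    by have := mkseq_nth false w; rewrite !size_tuple.
  by rewrite -catA -sW1 wire_values_shift.
have /andP[_ /allP wfO] := circuit_wf C.
congr (_ ++ _); apply/eq_in_map => i /wfO lt_i /=.
  by rewrite nth_cat sW1 lt_i.
by rewrite -sW1 nth_cat ltnNge leq_addr addKn.
Qed.

End PigeonCircuit.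

(** * Solutions of the constructed Pigeon instance *)

Section Correctness.
Variable I : ws_input.
Hypothesis validI : ws_valid I.
Let n := ws_n I.
Let C := ws_C I.
Let w := enc_ws I.
Let gp := gates_at w.
Let op := outputs_at w.
Let ab := colour C (ws_a I) (ws_b I).
Let ac := colour C (ws_a I) (ws_c I).
Let j := size (first_diff ab ac).
Let o := nth 0 (outputs C) j.
Let v := nth false ab j.

Lemma separating_bit : j < n /\ v <> nth false ac j.
Proof.
have := @first_diffP ab ac; rewrite !size_tuple; apply=> //.
by have [_ ne] := validI => /val_inj.
Qed.

Lemma separating_wire : o < 2 * n + 2 * n + size (gates C).
Proof.
have /andP[_ /(all_nthP 0) wfO] := circuit_wf C.
by apply: wfO; rewrite size_tuple; have [] := separating_bit.
Qed.

Definition ws_pigeon : pigeon_input :=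
  pigeon_of (ws_a I) (ws_b I) (ws_c I) v separating_wire.

Lemma reductionE : reduction w = enc_pigeon ws_pigeon.
Proof.
rewrite enc_pigeon_of /reduction /reduction_of.
rewrite node_aE node_bE node_cE -/gp -/op.
rewrite -!/(col gp op _ _) !colE -/ab -/ac.
have -> : output_wire op (first_diff ab ac) = nseq o true.
  rewrite /op outputs_atE output_wireE // size_tuple.
  by have [] := separating_bit.
have shift_gatesE k : shift_gates_bits gp (nseq k true) =
    items enc_gate [seq shift_gate k g | g <- gates C].
  by rewrite /gp; have [r ->] := gates_atE I; rewrite shift_gates_bits_enc.
have shift_natsE k : shift_nats_bits op (nseq k true) =
    items enc_nat [seq k + i | i <- outputs C].
  by rewrite /op outputs_atE shift_nats_bits_enc.
rewrite (shift_gatesE 0) (shift_natsE 0) /gp eval_gates_atE -/gp.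
rewrite size_wire_values size_cat !size_tuple shift_gatesE shift_natsE.
have -> : [seq shift_gate 0 g | g <- gates C] = gates C.
  by rewrite -[RHS]map_id; apply: eq_map => -[].
have -> : [seq 0 + i | i <- outputs C] = outputs C by rewrite -[RHS]map_id.
rewrite bit_atE -/j -/v /pigeon_gates /pigeon_outputs !items_cat -!catA.
by [].
Qed.

Definition select (x : node n) : node n :=
  if nth false (colour C x (ws_a I)) j == v then ws_c I else ws_b I.

Lemma ws_pigeonE (x : node n) :
  val (ceval (pg_f ws_pigeon) x) = colour C x (ws_a I) ++ colour C x (select x).
Proof.
rewrite pigeon_ofE; congr (_ ++ val (colour C x (if _ == v then _ else _))).
by rewrite /= (nth_map 0) // size_tuple; have [] := separating_bit.
Qed.

(** The two candidate colours have opposite bits at [j], and [select] takes the candidate whose bit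
    differs from that of the colour of [x] and [a]. *)
Lemma selectP (x : node n) : colour C (ws_a I) (select x) <> colour C x (ws_a I).
Proof.
have [_ ne] := separating_bit; rewrite /select; case: eqP => [e|ne'] e'.
  by apply: ne; rewrite -e -e'.
by apply: ne'; rewrite -e'.
Qed.

Lemma select_neq x : val (ws_a I) != val (select x).
Proof.
have [[ab_ne ac_ne _] _] := validI.
by rewrite /select val_eqE; case: ifP => _; apply/eqP.
Qed.

Lemma select_mem x y z :
  val (select x) \in map val [:: ws_a I; ws_b I; ws_c I; y; z].
Proof. by rewrite /select !inE; case: ifP; rewrite eqxx ?orbT. Qed.

Lemma colour_val (p q p' q' : node n) :
  (col gp op p q = col gp op p' q') <-> (colour C p q = colour C p' q').
Proof. by rewrite !colE; split=> [/val_inj|->]. Qed.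

Lemma clean_no_zero y (x : node n) :
  clean gp op (map val [:: ws_a I; ws_b I; ws_c I; x; y]) ->
  ceval (pg_f ws_pigeon) x <> pg_v ws_pigeon.
Proof.
(* The [2 * n] zeros split into two equal colours. *)
have vE : val (pg_v ws_pigeon) = nseq n false ++ nseq n false.
  by rewrite -nseqD addnn -mul2n.
move=> cl /(congr1 val); rewrite ws_pigeonE vE.
move/eqP; rewrite eqseq_cat ?size_tuple ?size_nseq // => /andP[/eqP e1 /eqP e2].
have an : val (ws_a I) \in map val [:: ws_a I; ws_b I; ws_c I; x; y].
  by rewrite inE eqxx.
have xn : val x \in map val [:: ws_a I; ws_b I; ws_c I; x; y].
  by rewrite !inE eqxx !orbT.
apply: (clean_no_value cl an (select_mem x x y) (select_neq x) xn).
  by rewrite colour_val; apply: selectP.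
by rewrite !colE e1 e2.
Qed.

Lemma clean_no_collision (x y : node n) :
  clean gp op (map val [:: ws_a I; ws_b I; ws_c I; x; y]) ->
  ceval (pg_f ws_pigeon) x = ceval (pg_f ws_pigeon) y -> x = y.
Proof.
move=> cl /(congr1 val); rewrite !ws_pigeonE.
move/eqP; rewrite eqseq_cat ?size_tuple // => /andP[/eqP/val_inj e1 /eqP/val_inj].
(* The first halves of the values agree, and [select] is a function of that half. *)
have -> : select y = select x by rewrite /select e1.
move=> e2; apply: val_inj.
apply: (clean_injective cl _ (select_mem x x y) (select_neq x)).
- by rewrite inE eqxx.
- by rewrite !inE eqxx !orbT.
- by rewrite !inE eqxx !orbT.
- by rewrite colour_val; apply: selectP.
- by rewrite colour_val.
- by rewrite colour_val.
Qed.

(** Every word in a violation comes from the list, hence is a genuine node of length [2 * n], and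
    comparing colours as words is comparing them as tuples. *)
Lemma violation_solution (nodes : seq (node n)) s :
  violation gp op (map val nodes) s -> ws_solution I s.
Proof.
case=> [[_ [_ [_ [[/mapP[p _ ->] /mapP[q _ ->] /mapP[r _ ->]] [-> v3]]]]]
       |[_ [_ [/mapP[p _ ->] /mapP[q _ ->] -> v2]]]]; [left|right].
  exists p, q, r; case/and5P: v3 => pq pr qr /eqP/colour_val e1 ne2.
  split=> //; last by move/colour_val => e2; rewrite e2 eqxx in ne2.
  by split=> e; move: pq pr qr; rewrite e eqxx.
exists p, q; split=> //; last by move/colour_val => e; rewrite /asymmetric e eqxx in v2.
by move=> e; rewrite /asymmetric e eqxx in v2.
Qed.

(** [H] is the alternative offered by the search; the given Pigeon solution refutes its clean case,
    a preimage of zero being used for both [x] and [y]. *)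
Lemma solver_solution s :
  pigeon_solution ws_pigeon s -> ws_solution I (solver w s).
Proof.
pose sol x y := search gp op (triples 5) (map val [:: ws_a I; ws_b I; ws_c I; x; y]).
suff H x y : clean gp op (map val [:: ws_a I; ws_b I; ws_c I; x; y]) \/
    ws_solution I (sol x y).
  case=> [[x [-> zx]]|[x [y [-> xy cxy]]]].
    have -> : solver w (enc_seq enc_bits [:: val x]) = sol x x.
      congr search; rewrite /solver_nodes node_aE node_bE node_cE /=.
      by rewrite skip_bits_enc read_bits_enc.
    by have [/clean_no_zero|] := H x x.
  have -> : solver w (enc_seq enc_bits [:: val x; val y]) = sol x y.
    congr search; rewrite /solver_nodes node_aE node_bE node_cE /=.
    by rewrite skip_bits_enc /= !read_bits_enc.
  by have [/clean_no_collision/(_ cxy)|] := H x y.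
by have [/violation_solution|] := search_violation gp op
  (map val [:: ws_a I; ws_b I; ws_c I; x; y]); [right|left].
Qed.

End Correctness.

(** An injective map of a finite set to itself is onto, so it attains [v]; otherwise there is a
    collision. *)
Lemma pigeon_total : total_problem Pigeon.
Proof.
move=> _ [[n f v] ->].
have [inj|/injectivePn[x [y xy e]]] := boolP (injectiveb (ceval f)); last first.
  exists (enc_seq enc_bits [:: val x; val y]), (MkPigeon f v) => //.
  by right; exists x, y; split=> //; apply/eqP.
have /codomP[x ->] : v \in codom (ceval f) by apply/inj_card_onto => //; exact/injectiveP.
exists (enc_seq enc_bits [:: val x]), (MkPigeon f (ceval f x)) => //.
by left; exists x.
Qed.

Lemma total_reducible (R S : search_problem) :
  total_problem S -> reducible R S -> total_problem R.
Proof.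
move=> tS [f [g [_ _ fg]]] x /fg[/tS[y sol] gP].
by exists (g [tuple x; y]); apply: gP.
Qed.

Lemma ward_szabo_ppp : PPP WardSzabo.
Proof.
exists (fun xs => reduction (nth [::] xs 0)),
  (fun xs => solver (nth [::] xs 0) (nth [::] xs 1)).
split.
- by apply/ptime_polytime/ptime_reduction/(@ptime_var _ 0).
- apply/ptime_polytime/ptime_solver; [exact: (@ptime_var _ 0)|exact: (@ptime_var _ 1)].
move=> _ [I validI ->] /=; rewrite (reductionE validI); split; first by eexists.
(* [solution] speaks of some instance with this encoding; injectivity of [enc_pigeon] identifies it
   with [ws_pigeon]. *)
move=> s [P /enc_pigeon_inj <- sol]; exists I; split=> //.
exact: solver_solution sol.
Qed.

Theorem theorem3 : total_problem WardSzabo /\ PPP WardSzabo.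
Proof.
split; last exact: ward_szabo_ppp.
exact: total_reducible pigeon_total ward_szabo_ppp.
Qed.
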